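(* Let $d\in\mathbb{N}$, let $V:\mathbb{Z}^d\to\mathbb{R}$, and let $H_V=-\Delta+V$ be the discrete Schrödinger operator on $\ell^2(\mathbb{Z}^d)$. If there exists $s\in\mathbb{N}_0$ such that $$V_n\leq \frac{d(4-d)}{4|n|^2}+\frac{1}{|n|^2}\sum_{j=1}^{s}\prod_{k=1}^{j}\frac{1}{\log_k|n|}$$ for all $n\in\mathbb{Z}^d$ with $|n|$ sufficiently large, then $H_V$ does not have a zero energy ground state, i.e. $0\notin\sigma_{\mathrm{p}}(H_V)$ or $0\neq\inf\sigma(H_V)$.
   Context: The discrete Laplacian is $(-\Delta\psi)_n:=\sum_{m\in\mathbb{Z}^d,\,|m-n|=1}(\psi_n-\psi_m)$ for $\psi:\mathbb{Z}^d\to\mathbb{C}$, $n\in\mathbb{Z}^d$, where $|\cdot|$ is the Euclidean norm; it is a bounded self-adjoint operator on $\ell^2(\mathbb{Z}^d)$. A potential $V:\mathbb{Z}^d\to\mathbb{R}$ is identified with the multiplication operator $(V\psi)_n=V_n\psi_n$ on its maximal domain $\{\psi\in\ell^2(\mathbb{Z}^d): V\psi\in\ell^2(\mathbb{Z}^d)\}$, and $H_V:=-\Delta+V$ is self-adjoint on this domain. $\sigma(H)$ and $\sigma_{\mathrm{p}}(H)$ denote the spectrum and the point spectrum (set of eigenvalues). Iterated logarithms: $\log_0x:=x$ and $\log_{k}x:=\log(\log_{k-1}x)$ for $k\in\mathbb{N}$ ($x$ large enough). Empty sums equal $0$. $\mathbb{N}=\{1,2,\dots\}$, $\mathbb{N}_0=\mathbb{N}\cup\{0\}$.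 *)

(* Defs.v *)
From HB Require Import structures.
From mathcomp Require Import all_boot all_order all_algebra.
From mathcomp Require Import complex.
From mathcomp Require Import all_classical all_reals all_analysis.

Set Implicit Arguments.
Unset Strict Implicit.
Unset Printing Implicit Defensive.

Import Order.TTheory GRing.Theory Num.Theory.

Local Open Scope classical_set_scope.
Local Open Scope complex_scope.
Local Open Scope ring_scope.

Definition znorm (R : realType) (d : nat) (n : 'rV[int]_d) : R :=
  Num.sqrt (\sum_(i < d) (n ord0 i)%:~R ^+ 2).

Lemma finite_neighbours (R : realType) (d : nat) (n : 'rV[int]_d) :
  finite_set [set m : 'rV[int]_d | znorm R (m - n) = 1].
Proof.
pose f (u : {ffun 'I_d -> 'I_3}) : 'rV[int]_d :=
  \row_i (n ord0 i + ((u i : nat)%:Z - 1)).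
apply: (@sub_finite_set _ _ (f @` [set: {ffun 'I_d -> 'I_3}])); last first.
  exact/finite_image/finite_finset.
move=> m /= mn1.
have sum1 : \sum_(i < d) (((m - n) ord0 i)%:~R : R) ^+ 2 = 1.
  rewrite -[LHS]sqr_sqrtr; last by apply: sumr_ge0 => i _; exact: sqr_ge0.
  by move: mn1; rewrite /znorm => ->; rewrite expr1n.
have le1 i : `|m ord0 i - n ord0 i| <= 1.
  have : (((m - n) ord0 i)%:~R : R) ^+ 2 <= 1.
    rewrite -[leRHS]sum1 (bigD1 i) //= lerDl.
    by apply: sumr_ge0 => j _; exact: sqr_ge0.
  rewrite !mxE -rmorphXn /= -[leRHS]/(1%:~R) ler_int.
  by rewrite -real_normK ?num_real// expr_le1.
exists [ffun i => inord (absz (m ord0 i - n ord0 i + 1))] => //.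
apply/rowP => i; rewrite mxE ffunE.
have := le1 i; rewrite ler_norml => /andP[h1 h2].
have h0 : 0 <= m ord0 i - n ord0 i + 1 by rewrite -lerBlDr sub0r.
have h3 : m ord0 i - n ord0 i + 1 <= 2 by rewrite -lerBrDr.
rewrite inordK.
  by rewrite gez0_abs// addrK addrC subrK.
by rewrite -ltz_nat gez0_abs//; apply: le_lt_trans h3 _.
Qed.

(* The sum ranges over the m at distance 1 from n, a finite set by
   [finite_neighbours]: [\sum_(m \in A)] would be 0 on an infinite support. *)
Definition neg_laplacian (R : realType) (d : nat) (psi : 'rV[int]_d -> R[i]) :
    'rV[int]_d -> R[i] :=
  fun n => \sum_(m \in [set m : 'rV[int]_d | znorm R (m - n) = 1])
             (psi n - psi m).

Definition l2sqnorm (R : realType) (d : nat) (psi : 'rV[int]_d -> R[i]) :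
    \bar R :=
  \esum_(n in [set: 'rV[int]_d])
     (complex.Re (psi n) ^+ 2 + complex.Im (psi n) ^+ 2)%:E.

Definition l2 (R : realType) (d : nat) : set ('rV[int]_d -> R[i]) :=
  [set psi | (l2sqnorm psi < +oo)%E].

Definition potential_mul (R : realType) (d : nat) (V : 'rV[int]_d -> R)
    (psi : 'rV[int]_d -> R[i]) : 'rV[int]_d -> R[i] :=
  fun n => (V n)%:C * psi n.

Definition schrodinger_dom (R : realType) (d : nat) (V : 'rV[int]_d -> R) :
    set ('rV[int]_d -> R[i]) :=
  [set psi | l2 psi /\ l2 (potential_mul V psi)].

Definition schrodinger (R : realType) (d : nat) (V : 'rV[int]_d -> R)
    (psi : 'rV[int]_d -> R[i]) : 'rV[int]_d -> R[i] :=
  fun n => neg_laplacian psi n + potential_mul V psi n.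

(* For an operator on l2 with domain D, only the values of A on D matter. *)
Section Spectrum.
Variables (R : realType) (d : nat).
Variables (D : set ('rV[int]_d -> R[i])).
Variable A : ('rV[int]_d -> R[i]) -> 'rV[int]_d -> R[i].

Definition shift_op (z : R[i]) (psi : 'rV[int]_d -> R[i]) :
    'rV[int]_d -> R[i] :=
  fun n => A psi n - z * psi n.

(* A - z is a bijection from D onto l2, with bounded inverse. *)
Definition resolvent_set : set R[i] :=
  [set z | set_bij D (@l2 R d) (shift_op z) /\
    exists C : R, forall psi, D psi ->
      (l2sqnorm psi <= C%:E * l2sqnorm (shift_op z psi))%E].

Definition spectrum : set R[i] := ~` resolvent_set.

Definition point_spectrum : set R[i] :=
  [set z | exists psi, [/\ D psi, exists n, psi n != 0 &
                           forall n, A psi n = z * psi n]].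

(* Infimum of the spectrum as a set of real numbers (the spectrum of a
   self-adjoint operator is real), in the extended reals because the operator
   may be unbounded below; [inf] would then return 0. *)
Definition inf_spectrum : \bar R :=
  ereal_inf [set x%:E | x in [set x : R | spectrum x%:C]].

End Spectrum.

Definition iter_log (R : realType) (k : nat) (x : R) : R := iter k (@ln R) x.

(* Main.v *)
(** A zero energy ground state would give, by positivity of the quadratic form of
    [H_V], a strictly positive square-summable [u] with [H_V u = 0].  With one more
    logarithm than in the hypothesis, the radial function
      [w = |n|^(-d/2) (log_1 |n| ... log_s |n|)^(-1/2)]
    satisfies [H_V w < 0] far out: the continuous Laplacian leaves a gain of order
    [w / (|n|^2 (log |n|)^2)], which beats the discretization error [O(w / |n|^4)].
    Comparing [w - e phi], where [phi = |n|^(1 - d/2)] is a supersolution, with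
    multiples of [u] and letting [e] tend to 0 gives [w <= C u], although [w] is
    not square-summable. *)

Require Import Defs.
From HB Require Import structures.
From mathcomp Require Import all_boot all_order all_algebra.
From mathcomp Require Import complex.
From mathcomp Require Import all_classical all_reals all_analysis.
From mathcomp Require Import ring lra.

Set Implicit Arguments.
Unset Strict Implicit.
Unset Printing Implicit Defensive.

Import Order.TTheory GRing.Theory Num.Theory.
Import numFieldNormedType.Exports.

Local Open Scope classical_set_scope.
Local Open Scope complex_scope.
Local Open Scope ring_scope.

(** * Absolutely convergent sums over a type *)

(** The condition on the infimum only says that negative energies lie in the resolvent set.
    Positivity of the form is extracted from it by a bootstrap on a bounded inverse, since the
    operator itself offers no lower bound to start from. It then makes the absolute value of the
    real or imaginary part of a zero mode again a zero mode. The constant of the hypothesis comes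
    from the exponent: for [|n|^(-c)] the continuous Laplacian produces the factor
    [c (c + 2 - d) / |n|^2], and the borderline of square summability [c = d/2] turns it into
    [d (4 - d) / (4 |n|^2)]. The logarithms stay on the borderline, as in the Bertrand series, and
    each accounts for one term of the hypothesis. For [s = 0] the pure power has no gain at all,
    hence the additional logarithm. No lower bound on the decay of [u] is known, so [w / u] might
    have no maximum. As [w / phi] tends to [0], subtracting [e phi] leaves only finitely many points
    to compare. *)

Section Sum.
Variables (R : realType) (T : choiceType).
Implicit Types (a b f g h : T -> R).

Definition etotal f : \bar R := \esum_(i in [set: T]) (f i)%:E.

Definition abs_summable f := (etotal (fun i => `|f i|%R) < +oo)%E.

(* Splitting [f] as [(|f| + f) - |f|] avoids positive and negative parts. *)
Definition total f : R :=
  fine (etotal (fun i => `|f i| + f i)) - fine (etotal (fun i => `|f i|)).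

Lemma etotal_ge0 f : (forall i, 0 <= f i) -> (0 <= etotal f)%E.
Proof. by move=> f0; apply: esum_ge0 => i _; rewrite lee_fin. Qed.

Lemma le_etotal f g : (forall i, f i <= g i) -> (etotal f <= etotal g)%E.
Proof. by move=> fg; apply: le_esum => i _; rewrite lee_fin. Qed.

Lemma etotalD a b : (forall i, 0 <= a i) -> (forall i, 0 <= b i) ->
  etotal (fun i => (a i + b i)%R) = (etotal a + etotal b)%E.
Proof.
by move=> a0 b0; rewrite -esumD// => i _; rewrite lee_fin.
Qed.

Lemma etotalZ_le c a : 0 <= c -> (forall i, 0 <= a i) ->
  (etotal (fun i => (c * a i)%R) <= c%:E * etotal a)%E.
Proof.
move=> c0 a0; apply: ge_ereal_sup => _ /= [X [finX _] <-].
rewrite (eq_fsbigr (fun i => (c%:E * (a i)%:E)%E)); last first.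
  by move=> i _; rewrite EFinM.
rewrite -ge0_mule_fsumr; last by move=> i; rewrite lee_fin.
by apply: lee_wpmul2l; rewrite ?lee_fin//; apply: esum_ge; exists X.
Qed.

Lemma le_abs_summable f g : (forall i, `|f i| <= `|g i|) ->
  abs_summable g -> abs_summable f.
Proof. by move=> fg; apply: le_lt_trans; exact: le_etotal. Qed.

Lemma abs_summableD f g : abs_summable f -> abs_summable g ->
  abs_summable (fun i => f i + g i).
Proof.
move=> fs gs; apply: (@le_lt_trans _ _ (etotal (fun i => `|f i| + `|g i|))).
  by apply: le_etotal => i; exact: ler_normD.
by rewrite etotalD//; exact: lte_add_pinfty.
Qed.

Lemma abs_summableZ c f : abs_summable f -> abs_summable (fun i => c * f i).
Proof.
move=> fs; rewrite /abs_summable.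
under [X in etotal X]funext => i do rewrite normrM.
apply: (le_lt_trans (etotalZ_le _ _)) => //.
by rewrite lte_mul_pinfty.
Qed.

Lemma abs_summableN f : abs_summable f -> abs_summable (fun i => - f i).
Proof.
move=> fs; apply: le_abs_summable fs => i; by rewrite normrN.
Qed.

Lemma abs_summableB f g : abs_summable f -> abs_summable g ->
  abs_summable (fun i => f i - g i).
Proof. by move=> fs gs; apply: abs_summableD => //; exact: abs_summableN. Qed.

Lemma abs_summable_fin a : (forall i, 0 <= a i) -> abs_summable a ->
  exists x, etotal a = x%:E.
Proof.
move=> a0 as_; exists (fine (etotal a)); rewrite fineK//; move: as_.
rewrite ge0_fin_numE ?etotal_ge0// /abs_summable.
by under [X in etotal X]funext => i do rewrite ger0_norm//.
Qed.

(** Every splitting gives the same value: [(|f| + f) + b = |f| + a] pointwise, and [etotal] is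
    additive on nonnegative functions. *)
Lemma total_split f a b : (forall i, 0 <= a i) -> (forall i, 0 <= b i) ->
  abs_summable a -> abs_summable b -> (forall i, f i = a i - b i) ->
  total f = fine (etotal a) - fine (etotal b).
Proof.
move=> a0 b0 as_ bs fE.
have fs : abs_summable f.
  have -> : f = (fun i => a i - b i) by apply/funext.
  exact: abs_summableB.
have fs' : abs_summable (fun i => `|f i|).
  by apply: le_abs_summable fs => i; rewrite normr_id.
have f0 i : 0 <= `|f i| + f i.
  by rewrite -lerBlDr sub0r -normrN ler_norm.
have E : (etotal (fun i => (`|f i| + f i)%R) + etotal b =
          etotal (fun i => `|f i|%R) + etotal a)%E.
  rewrite -!etotalD//; congr etotal; apply/funext => i.
  rewrite fE; lra.
have [x xE] := abs_summable_fin f0 (abs_summableD fs' fs).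
have [y yE] := abs_summable_fin (fun i => normr_ge0 (f i)) fs'.
have [z zE] := abs_summable_fin a0 as_.
have [t tE] := abs_summable_fin b0 bs.
by move: E; rewrite /total xE yE zE tE -!EFinD => -[] /=; lra.
Qed.

Lemma totalD f g : abs_summable f -> abs_summable g ->
  total (fun i => f i + g i) = total f + total g.
Proof.
move=> fs gs.
have abs_s h : abs_summable h -> abs_summable (fun i => `|h i|).
  by move=> hs; apply: le_abs_summable hs => i; rewrite normr_id.
have pos h i : 0 <= `|h i| + h i by rewrite -lerBlDr sub0r -normrN ler_norm.
rewrite (@total_split _ (fun i => (`|f i| + f i) + (`|g i| + g i))
                        (fun i => `|f i| + `|g i|)); first last.
- by move=> i; lra.
- by apply: abs_summableD; exact: abs_s.
- by do 2 apply: abs_summableD => //; exact: abs_s.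
- by move=> i; rewrite addr_ge0.
- by move=> i; rewrite addr_ge0.
rewrite /total (etotalD (pos f) (pos g)) (@etotalD (fun i => `|f i|) (fun i => `|g i|))//.
have [x ->] := abs_summable_fin (pos f) (abs_summableD (abs_s _ fs) fs).
have [y ->] := abs_summable_fin (fun i => normr_ge0 (f i)) (abs_s _ fs).
have [z ->] := abs_summable_fin (pos g) (abs_summableD (abs_s _ gs) gs).
have [t ->] := abs_summable_fin (fun i => normr_ge0 (g i)) (abs_s _ gs).
by rewrite -!EFinD /=; lra.
Qed.

Lemma total_fine f : (forall i, 0 <= f i) -> abs_summable f ->
  etotal f = (total f)%:E.
Proof.
move=> f0 fs.
rewrite (@total_split f f (fun=> 0))//; last 2 first.
- by apply: le_abs_summable fs => i; rewrite normr0.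
- by move=> i; rewrite subr0.
have [x ->] := abs_summable_fin f0 fs.
by rewrite /etotal esum1//= subr0.
Qed.

Lemma total0 : total (fun=> 0) = 0.
Proof.
have s : abs_summable (fun=> 0).
  by rewrite /abs_summable /etotal esum1// => i _; rewrite normr0.
by apply/EFin_inj; rewrite -total_fine// /etotal esum1.
Qed.

Lemma total_ge0 f : abs_summable f -> (forall i, 0 <= f i) -> 0 <= total f.
Proof.
by move=> fs f0; rewrite -lee_fin -total_fine// etotal_ge0.
Qed.

Lemma totalN f : abs_summable f -> total (fun i => - f i) = - total f.
Proof.
move=> fs; apply/eqP; rewrite -subr_eq0 opprK; apply/eqP.
rewrite -totalD//; last exact: abs_summableN.
by rewrite -[RHS]total0; congr total; apply/funext => i; rewrite addNr.
Qed.

Lemma totalB f g : abs_summable f -> abs_summable g ->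
  total (fun i => f i - g i) = total f - total g.
Proof. by move=> fs gs; rewrite totalD ?totalN//; exact: abs_summableN. Qed.

Lemma totalZ c f : abs_summable f -> total (fun i => c * f i) = c * total f.
Proof.
wlog c0 : c / 0 < c => [wl|fs].
  have [/wl//|c0 fs|<- fs] := ltgtP 0 c; last first.
    rewrite mul0r -[RHS]total0; congr total.
    by apply/funext => i; rewrite mul0r.
  rewrite -[c]opprK mulNr -wl// ?oppr_gt0// -totalN; last exact: abs_summableZ.
  by congr total; apply/funext => i; rewrite !mulNr.
have nonneg e h : 0 <= e -> (forall i, 0 <= h i) -> abs_summable h ->
    total (fun i => e * h i) <= e * total h.
  move=> e0 h0 hs; rewrite -lee_fin EFinM -!total_fine//.
  - exact: etotalZ_le.
  - by move=> i; rewrite mulr_ge0.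
  - exact: abs_summableZ.
have pos h : (forall i, 0 <= h i) -> abs_summable h ->
    total (fun i => c * h i) = c * total h.
  move=> h0 hs; apply/le_anti/andP; split; first by apply: nonneg => //; exact: ltW.
  (* The reverse inequality is the same one with the factor [c^-1]. *)
  rewrite -ler_pdivlMl//.
  have {1}-> : h = (fun i => c^-1 * (c * h i)).
    by apply/funext => i; rewrite mulrA mulVf ?mul1r// gt_eqF.
  apply: nonneg; first by rewrite invr_ge0 ltW.
    by move=> i; rewrite mulr_ge0// ltW.
  exact: abs_summableZ.
have abs_s : abs_summable (fun i => `|f i|).
  by apply: le_abs_summable fs => i; rewrite normr_id.
have p0 i : 0 <= `|f i| + f i by rewrite -lerBlDr sub0r -normrN ler_norm.
have p_s : abs_summable (fun i => `|f i| + f i) by exact: abs_summableD.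
have fE : f = (fun i => (`|f i| + f i) - `|f i|) by apply/funext => i; lra.
rewrite [in RHS]fE totalB// mulrBr -pos// -pos// -totalB; last 2 first.
- exact: abs_summableZ.
- exact: abs_summableZ.
by congr total; apply/funext => i; lra.
Qed.

Lemma etotal_reindex (e : T -> T) f : bijective e ->
  (forall i, 0 <= f i) -> etotal (fun i => f (e i)) = etotal f.
Proof.
move=> be f0; apply/esym.
by apply: (@reindex_esum R T T setT setT e (fun i => (f i)%:E)); rewrite setTT_bijective.
Qed.

Lemma abs_summable_reindex (e : T -> T) f : bijective e ->
  abs_summable f -> abs_summable (fun i => f (e i)).
Proof.
by move=> be; rewrite /abs_summable (@etotal_reindex e (fun i => `|f i|)).
Qed.

Lemma total_reindex (e : T -> T) f : bijective e ->
  total (fun i => f (e i)) = total f.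
Proof.
move=> be; rewrite /total (@etotal_reindex e (fun i => `|f i|))//.
rewrite (@etotal_reindex e (fun i => `|f i| + f i))// => i.
by rewrite -lerBlDr sub0r -normrN ler_norm.
Qed.

Lemma total_sum (I : Type) (s : seq I) (F : I -> T -> R) :
  (forall k, abs_summable (F k)) ->
  abs_summable (fun i => \sum_(k <- s) F k i) /\
  total (fun i => \sum_(k <- s) F k i) = \sum_(k <- s) total (F k).
Proof.
move=> Fs; elim: s => [|k s [IH1 IH2]].
  have -> : (fun i => \sum_(k <- [::]) F k i) = (fun=> 0).
    by apply/funext => i; rewrite big_nil.
  rewrite big_nil total0; split=> //.
  by rewrite /abs_summable /etotal esum1// => i _; rewrite normr0.
have -> : (fun i => \sum_(k <- k :: s) F k i) = (fun i => F k i + \sum_(k <- s) F k i).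
  by apply/funext => i; rewrite big_cons.
rewrite big_cons totalD// IH2; split=> //; exact: abs_summableD.
Qed.

Lemma total_single p f : (forall i, i != p -> f i = 0) ->
  abs_summable f /\ total f = f p.
Proof.
move=> f0.
have E g : (forall i, i != p -> g i = 0) -> (forall i, 0 <= g i) ->
    etotal g = (g p)%:E.
  move=> gp g0; rewrite /etotal -(@esum_set1 _ _ p (fun i => (g i)%:E)) ?lee_fin//.
  rewrite [RHS]esum_mkcond; apply: eq_esum => i _; rewrite in_set1.
  by have [->|/gp ->] := eqVneq i p.
have E1 : etotal (fun i => `|f i|) = (`|f p|)%:E.
  by apply: E => // i ip; rewrite f0// normr0.
have E2 : etotal (fun i => `|f i| + f i) = (`|f p| + f p)%:E.
  apply: E => i; first by move=> ip; rewrite f0// normr0 addr0.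
  by rewrite -lerBlDr sub0r -normrN ler_norm.
rewrite /abs_summable /total E1 E2 ltry /=; split=> //; lra.
Qed.
End Sum.

(** * Real square-summable functions and nonnegative operators *)

Section L2.
Variables (R : realType) (T : choiceType).
Implicit Types (f g h : T -> R).

Definition l2r f := abs_summable (fun i => f i ^+ 2).

Definition ip f g : R := total (fun i => f i * g i).

Lemma l2rM f g : l2r f -> l2r g -> abs_summable (fun i => f i * g i).
Proof.
move=> f2 g2; apply: le_abs_summable (abs_summableD f2 g2) => i.
rewrite [leRHS]ger0_norm ?addr_ge0 ?sqr_ge0// ler_norml.
by apply/andP; split; nra.
Qed.

Lemma l2rDZ f g c : l2r f -> l2r g -> l2r (fun i => f i + c * g i).
Proof.
move=> f2 g2.
have s := abs_summableD (abs_summableZ 2 f2) (abs_summableZ (2 * c ^+ 2) g2).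
apply: le_abs_summable s => i.
rewrite ger0_norm ?sqr_ge0// ger0_norm; last by nra.
by have := sqr_ge0 (f i - c * g i); nra.
Qed.

Lemma ipC f g : ip f g = ip g f.
Proof. by congr total; apply/funext => i; rewrite mulrC. Qed.

Lemma ipDZl f g h c : l2r f -> l2r g -> l2r h ->
  ip (fun i => f i + c * g i) h = ip f h + c * ip g h.
Proof.
move=> f2 g2 h2; rewrite /ip -(totalZ c (l2rM g2 h2)) -totalD.
- by congr total; apply/funext => i; ring.
- exact: l2rM.
- by apply: abs_summableZ; exact: l2rM.
Qed.

Lemma ipDZr f g h c : l2r f -> l2r g -> l2r h ->
  ip h (fun i => f i + c * g i) = ip h f + c * ip h g.
Proof. by move=> *; rewrite ipC ipDZl// !(ipC h). Qed.

Lemma ip_ge0 f : l2r f -> 0 <= ip f f.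
Proof.
by move=> f2; apply: total_ge0; [exact: l2rM|move=> i; rewrite -expr2 sqr_ge0].
Qed.

Lemma ip_sqDZ f g c : l2r f -> l2r g ->
  ip (fun i => f i + c * g i) (fun i => f i + c * g i) =
  ip f f + 2 * c * ip f g + c ^+ 2 * ip g g.
Proof.
move=> f2 g2; rewrite ipDZl ?ipDZr//; last exact: l2rDZ.
by rewrite (ipC g f); ring.
Qed.

Lemma ip_bound f g : l2r f -> l2r g -> - (ip f f + ip g g) <= 2 * ip f g.
Proof.
by move=> f2 g2; have := ip_ge0 (l2rDZ 1 f2 g2); rewrite ip_sqDZ//; lra.
Qed.

End L2.

(** * Nonnegative forms from a resolvent set containing the half-line [mu <= 0] *)

Section Nonnegative.
Variables (R : realType) (T : choiceType).
Variables (D : set (T -> R)) (L : (T -> R) -> T -> R).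
Hypothesis D_l2 : forall f, D f -> l2r f.
Hypothesis L_l2 : forall f, D f -> l2r (L f).
Hypothesis D_lin : forall f g c, D f -> D g -> D (fun i => f i + c * g i).
Hypothesis L_lin : forall f g c,
  L (fun i => f i + c * g i) = (fun i => L f i + c * L g i).
Hypothesis L_sym : forall f g, D f -> D g -> ip f (L g) = ip (L f) g.
Hypothesis L_surj : forall g, l2r g -> exists2 f, D f & L f = g.
Hypothesis L_inv : forall mu, mu <= 0 -> exists C, forall f, D f ->
  ip f f <= C * ip (fun i => L f i - mu * f i) (fun i => L f i - mu * f i).

Let L_invS mu : mu <= 0 -> exists2 C, 0 < C & forall f, D f ->
  ip f f <= C * ip (fun i => L f i - mu * f i) (fun i => L f i - mu * f i).
Proof.
move=> /L_inv[C CP]; exists (`|C| + 1) => [|f Df].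
  by rewrite ltr_wpDl.
apply: le_trans (CP f Df) _; apply: ler_wpM2r.
  apply: ip_ge0; have := l2rDZ (- mu) (L_l2 Df) (D_l2 Df).
  by under [X in l2r X -> _]funext => i do rewrite mulNr.
by rewrite (le_trans (ler_norm C))// lerDl.
Qed.

(** With [g = L f] this says that [m] bounds the form of [L^-1] from below. Unlike [L], the operator
    [L^-1] is bounded, so such an [m] exists from the outset. *)
Let bounded_below := [set m : R | forall f, D f -> m * ip (L f) (L f) <= ip f (L f)].

(* With [A = L^-1 - m], the form [<A g, g>] is nonnegative and Cauchy-Schwarz
   gives [|A g|^2 <= K <A g, g>]; the bounded inverse of [L - 1/m] then improves
   the lower bound [m] as long as [m < 0]. *)
Let improve m : m < 0 -> bounded_below m ->
  exists2 e, 0 < e & bounded_below (m + e).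
Proof.
move=> m0 mP.
have [C C0 CP] := L_invS (lexx 0).
have [C' C'0 C'P] : exists2 C, 0 < C & forall f, D f ->
    ip f f <= C * ip (fun i => L f i - m^-1 * f i) (fun i => L f i - m^-1 * f i).
  by apply: L_invS; rewrite ltW// invr_lt0.
have {}CP f : D f -> ip f f <= C * ip (L f) (L f).
  move=> Df; have := CP f Df.
  by under eq_fun do rewrite mul0r subr0.
(* [<A h, h> <= K |h|^2], because [2 <L^-1 h, h> <= (C + 1) |h|^2]. *)
pose K := C + 1 - m.
have K0 : 0 < K by rewrite /K; lra.
(* With [h] and [Q] as below, the chain [|L f|^2 = m^-2 |f - h|^2 <= 2 m^-2 (|f|^2 + |h|^2)],
   [|f|^2 <= C' m^-2 |h|^2], [|h|^2 <= K Q] yields [|L f|^2 <= M Q]. *)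
pose M := 2 * (1 + C' * m^-1 ^+ 2) * m^-1 ^+ 2 * K.
have m2 : 0 < m^-1 ^+ 2 by rewrite exprn_even_gt0 //= invr_eq0 lt_eqF.
have cm : 0 < 1 + C' * m^-1 ^+ 2 by rewrite addr_gt0// mulr_gt0.
have M0 : 0 < M by apply: mulr_gt0 => //; apply: mulr_gt0 => //; apply: mulr_gt0.
exists M^-1; first by rewrite invr_gt0.
move=> f Df.
(* With [g = L f], the function [h] is [A g], and [Q] is [<A g, g>]. *)
have [h hE] : exists h, h = (fun i => f i + (- m) * L f i) by eexists.
have f2 := D_l2 Df. have g2 := L_l2 Df.
have h2 : l2r h by rewrite hE; exact: l2rDZ.
have [k Dk kE] := L_surj h2.
have k2 := D_l2 Dk.
pose Q := ip f (L f) - m * ip (L f) (L f).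
have hh : ip h h = ip f h - m * ip (L f) h by rewrite {1}hE ipDZl// mulNr.
have kh : 2 * ip k h <= (C + 1) * ip h h.
  have := ip_ge0 (l2rDZ (-1) k2 h2); rewrite ip_sqDZ//.
  by have := CP _ Dk; rewrite kE; nra.
have hQ : ip h h <= K * Q.
  (* The form of [A] at [g - h / K] is [Q - 2 |h|^2 / K + <A h, h> / K^2], hence at most
     [Q - |h|^2 / K]. *)
  have := mP _ (D_lin (- K^-1) Df Dk).
  rewrite L_lin kE ip_sqDZ// ipDZl//; last exact: l2rDZ.
  rewrite !ipDZr// (_ : ip k (L f) = ip f h); last by rewrite -kE L_sym// ipC.
  have h0 := ip_ge0 h2.
  set s := K^-1; have sK : s * K = 1 by rewrite mulVf// gt_eqF.
  have s0 : 0 < s by rewrite invr_gt0.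
  have H : s ^+ 2 * (ip k h - m * ip h h) <= s * ip h h.
    rewrite -[in leRHS](mulr1 s) -sK expr2 -!mulrA ler_pM2l// ler_pM2l//.
    by rewrite /K; nra.
  move=> H'.
  have E : s * ip h h = s * ip f h - m * (s * ip (L f) h) by rewrite hh; ring.
  have : s * ip h h <= Q by rewrite /Q; nra.
  by rewrite ler_pdivrMl.
(* [L f - f / m] is [- h / m], so the resolvent bound at [m^-1] controls [f] by [h]. *)
have fC : ip f f <= C' * (m^-1 ^+ 2 * ip h h).
  have := C'P f Df.
  have -> : (fun i => L f i - m^-1 * f i) = (fun i => - m^-1 * h i).
    by apply/funext => i; rewrite hE; field; rewrite lt_eqF.
  suff -> : ip (fun i => - m^-1 * h i) (fun i => - m^-1 * h i) = m^-1 ^+ 2 * ip h h by [].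
  rewrite /ip -totalZ; last exact: l2rM.
  by congr total; apply/funext => i; ring.
have gg : ip (L f) (L f) = m^-1 ^+ 2 * (ip f f - 2 * ip f h + ip h h).
  have -> : ip f f - 2 * ip f h + ip h h =
            ip (fun i => f i + (-1) * h i) (fun i => f i + (-1) * h i).
    by rewrite ip_sqDZ//; ring.
  rewrite /ip -totalZ; last by apply: l2rM; exact: l2rDZ.
  by congr total; apply/funext => i; rewrite hE; field; rewrite lt_eqF.
have fh := ip_bound f2 h2.
have gM : ip (L f) (L f) <= M * Q.
  have H1 : ip f f - 2 * ip f h + ip h h <= 2 * (ip f f + ip h h) by lra.
  rewrite gg /M -mulrA.
  apply: (@le_trans _ _ (m^-1 ^+ 2 * (2 * (1 + C' * m^-1 ^+ 2) * ip h h))).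
    by rewrite ler_pM2l//; nra.
  rewrite mulrCA -!mulrA ler_pM2l// [leRHS]mulrCA.
  rewrite [leRHS](_ : _ = (1 + C' * m^-1 ^+ 2) * (m^-1 ^+ 2 * (K * Q))); last by ring.
  rewrite [leLHS](_ : _ = (1 + C' * m^-1 ^+ 2) * (m^-1 ^+ 2 * ip h h)); last by ring.
  by rewrite ler_pM2l ?ler_pM2l//; nra.
rewrite mulrDl -lerBrDl ler_pdivrMl//.
Qed.

(** Otherwise the best lower bound of [L^-1] is a finite negative number, itself a lower bound,
    which [improve] would raise. *)
Lemma form_nonneg f : D f -> 0 <= ip f (L f).
Proof.
move=> Df; rewrite leNgt; apply/negP => fL.
have [C C0 CP] := L_invS (lexx 0).
have b0 : bounded_below (- (C + 1)).
  move=> g Dg; have := CP _ Dg; under eq_fun do rewrite mul0r subr0.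
  have := ip_bound (D_l2 Dg) (L_l2 Dg); have := ip_ge0 (L_l2 Dg); nra.
have g0 : 0 < ip (L f) (L f).
  rewrite lt_neqAle (ip_ge0 (L_l2 Df)) andbT eq_sym; apply/eqP => g0.
  by have := b0 _ Df; rewrite g0 mulr0 leNgt fL.
have ub : ubound bounded_below (ip f (L f) / ip (L f) (L f)).
  by move=> m /(_ _ Df); rewrite ler_pdivlMr.
have hs : has_sup bounded_below.
  by split; [exists (- (C + 1))|exists (ip f (L f) / ip (L f) (L f))].
have m0 : sup bounded_below < 0.
  apply: le_lt_trans (ge_sup (proj1 hs) ub) _.
  by rewrite pmulr_llt0 ?invr_gt0.
have [e e0 /(ub_le_sup (proj2 hs))] : exists2 e, 0 < e & bounded_below (sup bounded_below + e).
  apply: improve => // g Dg.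
  have [gg0|gg0] := ltrP 0 (ip (L g) (L g)).
    rewrite -ler_pdivlMr//; apply: ge_sup (proj1 hs) _ => m /(_ _ Dg).
    by rewrite ler_pdivlMr.
  have {}gg0 : ip (L g) (L g) = 0 by apply/le_anti; rewrite gg0 ip_ge0//; exact: L_l2.
  by have := b0 _ Dg; rewrite gg0 !mulr0.
by rewrite gerDl leNgt e0.
Qed.

End Nonnegative.

(** * The Schrodinger operator on real functions *)

Section Lattice.
Variables (R : realType) (d : nat).
Local Notation point := 'rV[int]_d.
Implicit Types (n m : point) (p : 'I_d * bool) (f g V : point -> R).

(** Neighbours are indexed by direction and sign ([true] is the negative one), which turns the
    Laplacian into a sum over a finite type. *)
Definition step p : point := \row_i (if i == p.1 then (-1) ^+ p.2 else 0).

Lemma stepE p i : step p ord0 i = if i == p.1 then (-1) ^+ p.2 else 0.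
Proof. by rewrite mxE. Qed.

Lemma step_flip p : step (p.1, ~~ p.2) = - step p.
Proof.
apply/rowP => i; rewrite !mxE /=; case: eqP => _; last by rewrite oppr0.
by case: p.2; rewrite /= ?opprK.
Qed.

Lemma step_inj : injective step.
Proof.
move=> [i b] [j c] /rowP E.
have := E i; rewrite !mxE /= eqxx; case: eqP => [->|_]; last by case: (b).
by case: b c {E} => -[].
Qed.

Lemma znorm_sq n : znorm R n ^+ 2 = \sum_(i < d) (n ord0 i)%:~R ^+ 2.
Proof. by rewrite sqr_sqrtr// sumr_ge0// => i _; rewrite sqr_ge0. Qed.

Lemma znorm_ge0 n : 0 <= znorm R n.
Proof. exact: sqrtr_ge0. Qed.

Lemma znorm_step p : znorm R (step p) = 1.
Proof.
rewrite /znorm (bigD1 p.1)//= big1 => [|i ip].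
  by rewrite addr0 stepE eqxx; case: p.2;
    rewrite ?expr1 ?rmorphN ?sqrrN rmorph1 expr1n sqrtr1.
by rewrite stepE (negbTE ip) expr0n.
Qed.

Lemma znorm1P n : znorm R n = 1 -> exists p, n = step p.
Proof.
move=> n1.
have sq1 : (\sum_(i < d) (n ord0 i) ^+ 2 = 1)%R.
  apply/eqP; rewrite -(eqr_int R) rmorph_sum/=.
  under eq_bigr do rewrite rmorphXn.
  by rewrite -znorm_sq n1 expr1n.
have [i ni] : exists i, n ord0 i != 0.
  apply: contrapT => H; move: sq1; rewrite big1// => i _.
  by have [->|ni] := eqVneq (n ord0 i) 0; [rewrite expr0n|case: H; exists i].
have sqi : 1 <= (n ord0 i) ^+ 2 by rewrite -gtz0_ge1 exprn_even_gt0.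
move: (sq1); rewrite (bigD1 i)//= => sqE.
have rest0 : \sum_(j < d | j != i) n ord0 j ^+ 2 >= 0.
  by apply: sumr_ge0 => j _; exact: sqr_ge0.
have sqi1 : n ord0 i ^+ 2 = 1 by lra.
have rest : \sum_(j < d | j != i) n ord0 j ^+ 2 = 0 by lra.
have nj j : j != i -> n ord0 j = 0.
  move=> ji; apply/eqP; rewrite -sqrf_eq0.
  by apply/eqP/(psumr_eq0P _ rest) => // k _; exact: sqr_ge0.
exists (i, n ord0 i == -1); apply/rowP => j; rewrite mxE /=.
case: eqP => [->|/eqP/nj//].
by move/eqP: sqi1; rewrite sqrf_eq1 => /orP[/eqP ->|/eqP ->].
Qed.

Lemma neg_laplacianE (psi : point -> R[i]) n :
  neg_laplacian psi n = \sum_p (psi n - psi (n + step p)).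
Proof.
rewrite /neg_laplacian (@fsbigE _ _ _ _ _ [seq n + step p | p <- index_enum _]).
- rewrite big_map big_mkcond/=; apply: eq_bigr => p _.
  by rewrite mem_set//= addrC addKr znorm_step.
- rewrite map_inj_uniq ?index_enum_uniq// => p q /addrI; exact: step_inj.
- by move=> _ /= /mapP[p _ ->]; rewrite addrC addKr znorm_step.
- move=> m /= /znorm1P[p mE] /negP[]; apply/mapP; exists p.
    exact: mem_index_enum.
  by rewrite -mE addrC subrK.
Qed.

Definition lap (f : point -> R) n : R := \sum_p (f n - f (n + step p)).

Definition hop (V f : point -> R) n : R := lap f n + V n * f n.

Definition hop_dom (V : point -> R) : set (point -> R) :=
  [set f | l2r f /\ l2r (fun n => V n * f n)].

Lemma shift_bij (a : point) : bijective (fun n => n + a).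
Proof. by exists (fun n => n - a) => n; rewrite ?addrK ?subrK. Qed.

Lemma l2r_shift (a : point) f : l2r f -> l2r (fun n => f (n + a)).
Proof. exact: (@abs_summable_reindex _ _ _ (fun i => f i ^+ 2) (shift_bij a)). Qed.

Lemma l2r_lap f : l2r f -> l2r (lap f).
Proof.
move=> f2; rewrite /lap; elim: (index_enum _) => [|p s IH].
  rewrite /l2r; under eq_fun do rewrite big_nil expr0n.
  by rewrite /abs_summable /etotal esum1// => i _; rewrite normr0.
have := l2rDZ (-1) (l2rDZ 1 f2 IH) (l2r_shift (step p) f2).
by congr l2r; apply/funext => n; rewrite big_cons; ring.
Qed.

(** Translations by [step p] and [- step p] are adjoint to each other, and flipping the sign
    permutes the steps. *)
Lemma ip_lap f g : l2r f -> l2r g -> ip f (lap g) = ip (lap f) g.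
Proof.
move=> f2 g2.
have E u v : l2r u -> l2r v ->
    ip u (lap v) = \sum_(p : 'I_d * bool) ip u v - \sum_p ip u (fun n => v (n + step p)).
  move=> u2 v2; rewrite -sumrB; transitivity (total (fun n => \sum_p (u n * (v n - v (n + step p))))).
    by congr total; apply/funext => n; rewrite mulr_sumr.
  have s p : abs_summable (fun n => u n * v (n + step p)).
    by apply: l2rM => //; exact: l2r_shift.
  rewrite (proj2 (total_sum _ _)) => [|p].
    apply: eq_bigr => p _; rewrite -totalB//; last exact: l2rM.
    by congr total; apply/funext => n; rewrite mulrBr.
  under eq_fun do rewrite mulrBr.
  by apply: abs_summableB => //; exact: l2rM.
rewrite [RHS]ipC !E//; congr (_ - _).
  by apply: eq_bigr => p _; rewrite ipC.
rewrite (reindex_inj (inv_inj (_ : involutive (fun p : 'I_d * bool => (p.1, ~~ p.2)))))/=.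
  apply: eq_bigr => p _; rewrite step_flip.
  rewrite [RHS]ipC /ip.
  rewrite -(@total_reindex _ _ _ (fun n => f n * g (n - step p)) (shift_bij (step p))).
  by congr total; apply/funext => n; rewrite addrK.
by move=> [i b] /=; rewrite negbK.
Qed.

Lemma hop_l2 V f : hop_dom V f -> l2r (hop V f).
Proof.
move=> [f2 Vf2]; have := l2rDZ 1 (l2r_lap f2) Vf2.
by congr l2r; apply/funext => n; rewrite mul1r.
Qed.

Lemma hop_lin V f g c :
  hop V (fun n => f n + c * g n) = (fun n => hop V f n + c * hop V g n).
Proof.
apply/funext => n; rewrite /hop.
have -> : lap (fun n => f n + c * g n) n = lap f n + c * lap g n.
  by rewrite /lap mulr_sumr -big_split/=; apply: eq_bigr => p _; ring.
ring.
Qed.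

Lemma hop_dom_lin V f g c : hop_dom V f -> hop_dom V g ->
  hop_dom V (fun n => f n + c * g n).
Proof.
move=> [f2 Vf2] [g2 Vg2]; split; first exact: l2rDZ.
have := l2rDZ c Vf2 Vg2.
by congr l2r; apply/funext => n; ring.
Qed.

Lemma hop_sym V f g : hop_dom V f -> hop_dom V g -> ip f (hop V g) = ip (hop V f) g.
Proof.
move=> [f2 Vf2] [g2 Vg2].
have hE h : hop V h = (fun n => lap h n + 1 * (V n * h n)).
  by apply/funext => n; rewrite mul1r.
rewrite !hE ipDZr ?l2r_lap// ipDZl ?l2r_lap// ip_lap//; congr (_ + _ * _).
by congr total; apply/funext => n; ring.
Qed.

End Lattice.

(** * Reduction from complex to real functions *)

Section RealForm.
Variables (R : realType) (d : nat) (V : 'rV[int]_d -> R).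
Local Notation point := 'rV[int]_d.
Implicit Types (f g : point -> R) (psi : point -> R[i]).

Let re psi n := complex.Re (psi n).
Let im psi n := complex.Im (psi n).

Lemma re_hop psi : re (schrodinger V psi) = hop V (re psi).
Proof.
have ReD : {morph (@complex.Re R) : x y / x + y} by move=> [a b] [a' b'].
apply/funext => n; rewrite /re /schrodinger neg_laplacianE ReD (big_morph _ ReD (erefl _)).
congr (_ + _).
  by apply: eq_bigr => p _; rewrite ReD; case: (psi (n + _)).
by rewrite /potential_mul; case: (psi n) => a b /=; rewrite mul0r subr0.
Qed.

Lemma im_hop psi : im (schrodinger V psi) = hop V (im psi).
Proof.
have ImD : {morph (@complex.Im R) : x y / x + y} by move=> [a b] [a' b'].
apply/funext => n; rewrite /im /schrodinger neg_laplacianE ImD (big_morph _ ImD (erefl _)).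
congr (_ + _).
  by apply: eq_bigr => p _; rewrite ImD; case: (psi (n + _)).
by rewrite /potential_mul; case: (psi n) => a b /=; rewrite mul0r addr0.
Qed.

Lemma l2_re_im psi : l2 psi -> l2r (re psi) /\ l2r (im psi).
Proof.
move=> psi2; split; apply: le_lt_trans psi2; apply: le_etotal => n;
  by rewrite ger0_norm ?sqr_ge0// ?lerDl ?lerDr sqr_ge0.
Qed.

Lemma schrodinger_dom_re_im psi : schrodinger_dom V psi ->
  hop_dom V (re psi) /\ hop_dom V (im psi).
Proof.
move=> [/l2_re_im[r2 i2] /l2_re_im[Vr2 Vi2]]; split; split=> //.
  move: Vr2; congr l2r; apply/funext => n; rewrite /re /potential_mul.
  by case: (psi n) => a b /=; rewrite mul0r subr0.
move: Vi2; congr l2r; apply/funext => n; rewrite /im /potential_mul.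
by case: (psi n) => a b /=; rewrite mul0r addr0.
Qed.

Lemma l2sqnorm_real f : l2sqnorm (fun n => (f n)%:C) = etotal (fun n => f n ^+ 2).
Proof. by apply: eq_esum => n _ /=; rewrite expr0n addr0. Qed.

Lemma l2_real f : l2r f -> l2 (fun n => (f n)%:C).
Proof.
move=> f2; rewrite /l2/= l2sqnorm_real; apply: le_lt_trans f2.
by apply: le_etotal => n; exact: ler_norm.
Qed.

Lemma l2sqnorm_ip f : l2r f -> l2sqnorm (fun n => (f n)%:C) = (ip f f)%:E.
Proof.
move=> f2; rewrite l2sqnorm_real total_fine//.
by move=> n; exact: sqr_ge0.
Qed.

(** The operator has real coefficients, so it commutes with taking real parts: the real part of a
    complex preimage of a real function is again a preimage. *)
Lemma resolvent_real (lam : R) :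
    resolvent_set (schrodinger_dom V) (schrodinger V) lam%:C ->
  (forall g, l2r g -> exists2 f, hop_dom V f & (fun n => hop V f n - lam * f n) = g) /\
  exists C, forall f, hop_dom V f ->
    ip f f <= C * ip (fun n => hop V f n - lam * f n) (fun n => hop V f n - lam * f n).
Proof.
move=> [[_ _ surj] [C CP]]; split=> [g g2|].
  have [psi psiD psiE] := surj _ (l2_real g2).
  exists (re psi); first exact: (schrodinger_dom_re_im psiD).1.
  apply/funext => n; rewrite -re_hop.
  have := congr1 (fun phi => complex.Re (phi n)) psiE.
  rewrite /shift_op /re /=; case: (psi n) => a b /=.
  by case: (schrodinger V psi n) => a' b' /=; rewrite mul0r subr0.
exists C => f [f2 Vf2].
have fD : schrodinger_dom V (fun n => (f n)%:C).
  split; first exact: l2_real.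
  have := l2_real Vf2; congr l2; apply/funext => n.
  by rewrite /potential_mul rmorphM.
have := CP _ fD.
have -> : shift_op (schrodinger V) lam%:C (fun n => (f n)%:C) =
          (fun n => (hop V f n - lam * f n)%:C).
  apply/funext => n; rewrite /shift_op /schrodinger neg_laplacianE /potential_mul.
  rewrite rmorphB rmorphD !rmorphM rmorph_sum/=; congr (_ + _ - _).
  by apply: eq_bigr => p _; rewrite rmorphB.
rewrite !l2sqnorm_ip//.
have := l2rDZ (- lam) (hop_l2 (conj f2 Vf2)) f2.
by congr l2r; apply/funext => n; rewrite mulNr.
Qed.

Lemma inf_spectrum0_form f :
    inf_spectrum (schrodinger_dom V) (schrodinger V) = 0%E ->
  hop_dom V f -> 0 <= ip f (hop V f).
Proof.
move=> inf0 fD.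
have res lam : lam < 0 -> resolvent_set (schrodinger_dom V) (schrodinger V) lam%:C.
  move=> lam0; apply: contrapT => H.
  have : (inf_spectrum (schrodinger_dom V) (schrodinger V) <= lam%:E)%E.
    by apply: ereal_inf_lbound; exists lam.
  by rewrite inf0 lee_fin leNgt lam0.
(* Zero may lie in the spectrum, while [form_nonneg] needs a bounded inverse at every [mu <= 0]; the
   shift by [e] provides it. *)
have shifted e : 0 < e -> 0 <= ip f (hop V f) + e * ip f f.
  move=> e0; rewrite -ipDZr; [|exact: hop_l2|exact: fD.1|exact: fD.1].
  apply: (@form_nonneg _ _ (hop_dom V) (fun g n => hop V g n + e * g n)) => //.
  - by move=> g [].
  - by move=> g gD; apply: l2rDZ; [exact: hop_l2|exact: gD.1].
  - by move=> g h c; exact: hop_dom_lin.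
  - by move=> g h c; apply/funext => n; rewrite hop_lin; ring.
  - move=> g h gD hD; rewrite (ipDZr e (hop_l2 hD) hD.1 gD.1).
    by rewrite (ipDZl e (hop_l2 gD) gD.1 hD.1) hop_sym.
  - move=> g g2; have [|+ _] := @resolvent_real (- e).
      by apply: res; rewrite oppr_lt0.
    move=> /(_ g g2)[h hD <-]; exists h => //.
    by apply/funext => n; rewrite mulNr opprK.
  - move=> mu mu0; have [|_ [C CP]] := @resolvent_real (mu - e).
      by apply: res; rewrite subr_lt0 (le_lt_trans mu0).
    exists C => g /CP; set u := (fun n => _); set v := (fun n => _).
    by suff -> : u = v by []; apply/funext => n; rewrite /u /v; ring.
rewrite leNgt; apply/negP => q0.
have ff := ip_ge0 fD.1.
(* This shift adds at most half of the absolute value of the negative form, so the sum stays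
   negative. *)
have /shifted : 0 < - ip f (hop V f) / (2 * (ip f f + 1)) by rewrite divr_gt0//; lra.
rewrite [X in _ + X](_ : _ = - ip f (hop V f) * (ip f f / (2 * (ip f f + 1)))); last by ring.
have : ip f f / (2 * (ip f f + 1)) <= 1 / 2 by rewrite ler_pdivrMr; lra.
nra.
Qed.

End RealForm.

(** * Positive zero modes *)

Section GroundState.
Variables (R : realType) (d : nat) (V : 'rV[int]_d -> R).
Local Notation point := 'rV[int]_d.

Lemma lattice_ind (Q : point -> Prop) : Q 0 -> (forall a b, Q a -> Q b -> Q (a + b)) ->
  (forall p, Q (step p)) -> forall a, Q a.
Proof.
move=> Q0 QD Qs a.
have -> : a = \sum_(i < d) step (i, a ord0 i < 0) *+ `|a ord0 i|.
  apply/rowP => j; rewrite summxE (bigD1 j)//= big1 => [|i ij].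
    rewrite addr0 mulmxnE stepE eqxx /=; case: ltrP => a0.
      by rewrite expr1 -mulr_natr mulN1r natz ltz0_abs// opprK.
    by rewrite expr0 natz gez0_abs.
  by rewrite mulmxnE stepE eq_sym (negbTE ij) mul0rn.
apply: big_ind => // i _; elim: (absz _) => [|k IH]; first by rewrite mulr0n.
by rewrite mulrS; exact: QD.
Qed.

(** A discrete Kato inequality: where [f n >= 0], passing to [|f|] can only raise the neighbouring
    values, which enter with a minus sign; elsewhere the same holds for [- f]. *)
Lemma hop_norm_le0 (f : point -> R) n : hop V f n = 0 -> hop V (fun m => `|f m|) n <= 0.
Proof.
move=> hf; have [f0|f0] := lerP 0 (f n).
  rewrite -hf /hop /lap ger0_norm// lerD2r; apply: ler_sum => p _.
  by rewrite lerD2l lerN2 ler_norm.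
rewrite -oppr0 -hf /hop /lap ltr0_norm// opprD mulrN lerD2r -sumrN.
apply: ler_sum => p _; rewrite opprB addrC lerD2r lerNl.
by rewrite -normrN ler_norm.
Qed.

(* Adding a small multiple of a delta function to [u] would otherwise make the
   quadratic form negative. *)
Lemma subsolution_solves (u : point -> R) :
    (forall f, hop_dom V f -> 0 <= ip f (hop V f)) ->
    hop_dom V u -> (forall n, 0 <= u n) -> (forall n, hop V u n <= 0) ->
  forall p, hop V u p = 0.
Proof.
move=> form uD u0 hu p; apply/eqP; rewrite eq_le hu/= leNgt; apply/negP => h0.
pose g (n : point) : R := (n == p)%:R.
have gz n : n != p -> g n = 0 by rewrite /g => /negbTE ->.
have gD : hop_dom V g.
  split; apply: (@total_single _ _ p _ _).1 => n /gz ->; first by rewrite expr0n.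
  by rewrite mulr0 expr0n.
have gp f : ip g f = f p.
  rewrite /ip (@total_single _ _ p _ _).2 ?/g ?eqxx ?mul1r// => n /negbTE ->.
  by rewrite mul0r.
have hu2 := hop_l2 uD. have hg2 := hop_l2 gD.
set c := hop V g p.
have q0 : ip u (hop V u) <= 0.
  rewrite -oppr_ge0 /ip -totalN; last exact: l2rM uD.1 hu2.
  apply: total_ge0 => [|n]; first by apply/abs_summableN/l2rM => //; exact: uD.1.
  by rewrite oppr_ge0 mulr_ge0_le0.
have H e : 0 <= 2 * e * hop V u p + e ^+ 2 * c.
  have := form _ (hop_dom_lin e uD gD).
  rewrite hop_lin ipDZl ?ipDZr//; try exact: uD.1; try exact: gD.1; last exact: l2rDZ.
  have ug : ip u (hop V g) = hop V u p by rewrite hop_sym// ipC gp.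
  by rewrite ug !gp -/c; nra.
(* Small enough for [e * c] to be at most [- hop V u p], so that the linear term decides the
   sign. *)
pose e := - hop V u p / (`|c| + 1).
have c1 : 0 < `|c| + 1 by rewrite ltr_wpDl.
have e0 : 0 < e by rewrite divr_gt0// oppr_gt0.
have ec : e * c <= - hop V u p.
  rewrite /e mulrAC ler_pdivrMr// ler_pM2l ?oppr_gt0//.
  by rewrite (le_trans (ler_norm c))// lerDl.
have := H e; rewrite expr2 -mulrA -mulrA (mulrCA 2) -mulrDr pmulr_rge0// leNgt.
by move/negP; apply; lra.
Qed.

(** Strong minimum principle: at a zero of [u] the equation says that the nonnegative neighbouring
    values sum to [0], so zeros spread over the whole lattice. *)
Lemma solution_gt0 (u : point -> R) : (forall n, 0 <= u n) ->
  (forall n, hop V u n = 0) -> (exists n, u n != 0) -> forall n, 0 < u n.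
Proof.
move=> u0 hu [m um] n; rewrite lt_neqAle u0 andbT eq_sym; apply/eqP => un.
move/eqP: um; apply.
suff : forall a, (fun a => forall n, u n = 0 -> u (n + a) = 0) a.
  by move=> /(_ (m - n) n un); rewrite addrC subrK.
apply: lattice_ind => [k|a b ua ub k|p k] uk; first by rewrite addr0.
  by rewrite addrA; apply/ub/ua.
have := hu k; rewrite /hop /lap uk mulr0 addr0.
under eq_bigr do rewrite add0r.
rewrite sumrN => /eqP; rewrite oppr_eq0 => /eqP /psumr_eq0P; exact.
Qed.

Lemma positive_zero_mode :
    inf_spectrum (schrodinger_dom V) (schrodinger V) = 0%E ->
    point_spectrum (schrodinger_dom V) (schrodinger V) 0 ->
  exists u : point -> R,
    [/\ l2r u, forall n, 0 < u n & forall n, hop V u n = 0].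
Proof.
move=> inf0 [psi [psiD [n psin] psi0]].
have form f := @inf_spectrum0_form _ _ V f inf0.
have [f fD [f0 hf]] : exists2 f, hop_dom V f & (exists n, f n != 0) /\ forall n, hop V f n = 0.
  have [reD imD] := schrodinger_dom_re_im psiD.
  have [re0|re0] := eqVneq (complex.Re (psi n)) 0.
    exists (fun n => complex.Im (psi n)) => //; split=> [|k].
      exists n; apply: contra psin => /eqP im0.
      by move: re0 im0; case: (psi n) => a b /= -> ->.
    by have := congr1 (@^~ k) (im_hop V psi); rewrite /= => <-; rewrite psi0 mul0r.
  exists (fun n => complex.Re (psi n)) => //; split=> [|k]; first by exists n.
  by have := congr1 (@^~ k) (re_hop V psi); rewrite /= => <-; rewrite psi0 mul0r.
have uD : hop_dom V (fun n => `|f n|).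
  have [f2 Vf2] := fD; split; [apply: le_abs_summable f2|apply: le_abs_summable Vf2].
    by move=> k; rewrite normrX normr_id -normrX.
  by move=> k; rewrite !normrX !normrM normr_id.
have hu := subsolution_solves form uD (fun k => normr_ge0 (f k)) (fun k => hop_norm_le0 (hf k)).
exists (fun k => `|f k|); split=> //; first exact: uD.1.
apply: solution_gt0 => //; have [k fk] := f0; exists k.
by rewrite normr_eq0.
Qed.

End GroundState.

(** * Comparison principle *)

Section Comparison.
Variables (R : realType) (d : nat).
Local Notation point := 'rV[int]_d.

Lemma coord_le_znorm (n : point) i : `|(n ord0 i)%:~R| <= znorm R n.
Proof.
rewrite -ler_sqr ?nnegrE ?znorm_ge0// znorm_sq -normrX ger0_norm ?sqr_ge0//.
by rewrite (bigD1 i)//= lerDl sumr_ge0// => j _; exact: sqr_ge0.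
Qed.

Lemma finite_ball (M : R) : finite_set [set n : point | znorm R n <= M].
Proof.
have [N MN] : exists N : nat, M <= N%:R.
  exists (Num.Def.archi_bound `|M|); apply: le_trans (ler_norm M) _.
  exact/ltW/archi_boundP.
pose f (u : {ffun 'I_d -> 'I_(N + N).+1}) : point := \row_i ((u i : nat)%:Z - N%:Z).
apply: (@sub_finite_set _ _ (f @` setT)); last exact/finite_image/finite_finset.
move=> n /= nM; exists [ffun i => inord (absz (n ord0 i + N%:Z))] => //.
apply/rowP => i; rewrite mxE ffunE.
have : `|n ord0 i| <= N%:Z.
  rewrite -(ler_int R) intr_norm.
  by apply: le_trans (coord_le_znorm n i) (le_trans nM _); rewrite -pmulrn.
rewrite ler_norml => /andP[h1 h2].
have h0 : 0 <= n ord0 i + N%:Z by rewrite -lerBlDr sub0r.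
rewrite inordK; first by rewrite gez0_abs// addrK.
rewrite -ltz_nat gez0_abs//.
by apply: (@le_lt_trans _ _ (N%:Z + N%:Z)); rewrite ?lerD2r// -PoszD ltz_nat.
Qed.

Lemma finite_argmax (T : eqType) (s : seq T) (h : T -> R) x :
  x \in s -> exists2 y, y \in s & forall z, z \in s -> h z <= h y.
Proof.
elim: s x => // a [|b s] IH x _.
  by exists a; rewrite ?mem_head// => z; rewrite inE => /eqP ->.
have [y ys yP] := IH b (mem_head _ _).
have [ay|ya] := leP (h a) (h y).
  by exists y => [|z]; rewrite in_cons ?ys ?orbT// => /predU1P[->//|/yP].
exists a; rewrite ?mem_head// => z /[!in_cons]/predU1P[->//|zs].
by apply: le_trans (ltW ya); apply: yP; rewrite in_cons.
Qed.

Lemma hop_le (V W : point -> R) f n : 0 <= f n -> V n <= W n -> hop V f n <= hop W f n.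
Proof. by move=> f0 VW; rewrite lerD2l ler_wpM2r. Qed.

(* Maximum principle for the quotient [(w - e phi) / u]. *)
Lemma comparison (V W u w phi : point -> R) (r : R) :
    (forall n, 0 < u n) -> (forall n, hop V u n = 0) -> (forall n, 0 < phi n) ->
    (forall n, r <= znorm R n ->
      [/\ V n <= W n, hop W w n < 0 & 0 <= hop W phi n]) ->
    (forall e, 0 < e -> exists M, forall n, e * phi n < w n -> znorm R n <= M) ->
  exists2 C, 0 < C & forall n, w n <= C * u n.
Proof.
move=> u0 hu phi0 out dom.
have [s sE] : exists s : seq point, [set n | znorm R n <= r] = [set` s].
  exact/finite_seqP/finite_ball.
(* Large enough for [w <= C u] on the ball, which forces the maximum below to lie outside. *)
pose C := 1 + \sum_(n <- s) `|w n| / u n.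
have C0 : 0 < C by rewrite ltr_pwDl// sumr_ge0// => n _; rewrite divr_ge0// ltW.
exists C => // n.
have inner m : znorm R m <= r -> w m <= C * u m.
  move=> mr; rewrite -ler_pdivrMr//.
  have ms : m \in s by have : [set n | znorm R n <= r] m by []; rewrite sE.
  apply: (@le_trans _ _ (`|w m| / u m)); first by rewrite ler_pM2r ?invr_gt0// ler_norm.
  rewrite /C (big_rem m)//= addrCA lerDl addr_ge0// sumr_ge0// => k _.
  by rewrite divr_ge0// ltW.
suff key e : 0 < e -> forall n, w n - e * phi n <= C * u n.
  apply/ler_addgt0Pr => e e0.
  have := key (e / phi n) (divr_gt0 e0 (phi0 n)) n.
  by rewrite divfK ?gt_eqF// lerBlDr.
move=> e0 {}n; rewrite leNgt; apply/negP => bad.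
pose v m := w m - e * phi m.
have [M MP] := dom e e0.
(* As [C u > 0], this set lies where [e phi < w], a bounded region, so the quotient attains its
   maximum. *)
have [t tE] : exists t : seq point, [set m | C * u m < v m] = [set` t].
  apply/finite_seqP/(sub_finite_set _ (finite_ball M)) => m /= vm; apply: MP.
  by rewrite -subr_gt0; apply: lt_trans vm; rewrite mulr_gt0.
have tP m : (m \in t) = (C * u m < v m).
  have E : is_true (C * u m < v m) = is_true (m \in t) := congr1 (@^~ m) tE.
  by apply/idP/idP; rewrite E.
have [k kt kmax] : exists2 k, k \in t & forall m, m \in t -> v m / u m <= v k / u k.
  by apply: (@finite_argmax _ t (fun m => v m / u m) n); rewrite tP.
set q := v k / u k in kmax.
have vk : v k = q * u k by rewrite /q divfK// gt_eqF.
have Cq : C < q by rewrite /q ltr_pdivlMr// -tP.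
have vq m : v m <= q * u m.
  have [/kmax|] := boolP (m \in t); first by rewrite ler_pdivrMr.
  by rewrite tP -leNgt => /le_trans; apply; rewrite ler_pM2r// ltW.
have rk : r <= znorm R k.
  rewrite leNgt; apply/negP => /ltW /inner; rewrite leNgt => /negP; apply.
  by move: kt; rewrite tP => /lt_le_trans; apply; rewrite gerBl mulr_ge0// ltW.
have [VW hw hphi] := out k rk.
(* Replacing [W] by the smaller [V] lowers the operator only where [v] is nonnegative. *)
have v0 : 0 <= v k by rewrite vk mulr_ge0 ?ltW// (lt_trans C0).
have hv0 : hop W v k < 0.
  have -> : v = (fun m => w m + (- e) * phi m) by apply/funext => m; rewrite mulNr.
  by rewrite hop_lin mulNr subr_lt0 (lt_le_trans hw)// mulr_ge0// ltW.
have := le_lt_trans (hop_le v0 VW) hv0; rewrite ltNge => /negP; apply.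
(* [q u] touches [v] from above at [k], hence [hop V v k >= q * hop V u k = 0]. *)
rewrite -(mulr0 q) -(hu k) /hop /lap mulrDr mulrCA -vk lerD2r mulr_sumr.
by apply: ler_sum => p _; rewrite mulrBr -vk lerD2l lerN2.
Qed.

End Comparison.

(** * Uniform third order expansions *)

Section Taylor.
Variable R : realType.

(** Mean value theorem from [0]. Each use raises the order by one, so Taylor bounds need only first
    derivatives. *)
Lemma bound_primitive (h h' : R -> R) (eta K : R) (k : nat) : 0 <= K ->
    (forall z : R, `|z| <= eta -> is_derive z (1 : R) h (h' z)) -> h 0 = 0 ->
    (forall z, `|z| <= eta -> `|h' z| <= K * `|z| ^+ k) ->
  forall z, `|z| <= eta -> `|h z| <= K * `|z| ^+ k.+1.
Proof.
move=> K0 dh h0 h'K z zeta.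
have [c cz ->] : exists2 c, `|c| <= `|z| & h z = h' c * z.
  have cont (a b : R) : (forall y, y \in `[a, b] -> `|y| <= eta) ->
      {within `[a, b], continuous h}.
    move=> ab; apply: derivable_within_continuous => y /ab /dh dhy.
    exact: ex_derive.
  have [z0|/ltW z0] := lerP 0 z.
    have z' y : y \in `[0, z] -> `|y| <= `|z|.
      by rewrite in_itv/= => /andP[y0 yz]; rewrite !ger0_norm.
    have ze y : y \in `[0, z] -> `|y| <= eta by move=> /z' /le_trans; apply.
    have [|c cz] := @MVT_segment R h h' 0 z z0 _ (cont _ _ ze).
      by move=> y yz; apply/dh/ze/subset_itv_oo_cc.
    by rewrite h0 !subr0 => hz; exists c => //; exact: z'.
  have z' y : y \in `[z, 0] -> `|y| <= `|z|.
    by rewrite in_itv/= => /andP[y0 yz]; rewrite !ler0_norm ?lerN2.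
  have ze y : y \in `[z, 0] -> `|y| <= eta by move=> /z' /le_trans; apply.
  have [|c cz] := @MVT_segment R h h' z 0 z0 _ (cont _ _ ze).
    by move=> y yz; apply/dh/ze/subset_itv_oo_cc.
  rewrite h0 !sub0r mulrN => /oppr_inj hz; exists c => //; exact: z'.
rewrite normrM exprSr mulrA ler_wpM2r//.
apply: le_trans (h'K _ (le_trans cz zeta)) _.
by rewrite ler_wpM2l// lerXn2r ?nnegrE.
Qed.

Definition taylor3 (g : R -> R) (g1 g2 g3 : R) :=
  exists eta K, 0 < eta /\
    forall z, `|z| <= eta -> `|g z - (g1 * z + g2 * z ^+ 2 + g3 * z ^+ 3)| <= K * `|z| ^+ 4.

Lemma taylor3_ln1D : taylor3 (fun z => ln (1 + z)) 1 (- 2^-1) 3^-1.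
Proof.
(* The error has derivative [- z^3 / (1 + z)], and [1 + z >= 1/2] for [|z| <= 1/2]. *)
exists 2^-1, 2; split; first by rewrite invr_gt0.
apply: (@bound_primitive _ (fun z => (1 + z)^-1 - (1 - z + z ^+ 2))) => //.
- move=> z; rewrite ler_norml => /andP[z1 _].
  have z0 : 0 < 1 + z by lra.
  have dz : is_derive (1 + z) (1 : R) (@ln R) (1 + z)^-1 by exact: is_derive1_ln.
  apply: is_derive_eq.
  rewrite /GRing.scale/=; field; lra.
- by rewrite addr0 ln1; ring.
- move=> z; rewrite ler_norml => /andP[z1 _].
  have z0 : 0 < 1 + z by lra.
  have -> : (1 + z)^-1 - (1 - z + z ^+ 2) = - z ^+ 3 / (1 + z) by field; rewrite gt_eqF.
  rewrite normrM normrN normfV (ger0_norm (ltW z0)) normrX mulrC ler_wpM2r//.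
  by rewrite -[leRHS]invrK lef_pV2 ?posrE ?invr_gt0//; lra.
Qed.

Lemma taylor3_expRB1 : taylor3 (fun z => expR z - 1) 1 2^-1 6^-1.
Proof.
exists 1, (expR 1); split=> //.
have e0 (z : R) : `|z| <= 1 -> `|expR z| <= expR 1 * `|z| ^+ 0.
  by move=> /ler_normlP[_ z1]; rewrite ger0_norm ?expR_ge0// expr0 mulr1 ler_expR.
have K0 : 0 <= expR 1 :> R by exact: expR_ge0.
have e1 (z : R) : `|z| <= 1 -> `|expR z - 1| <= expR 1 * `|z| ^+ 1.
  apply: (@bound_primitive (fun z => expR z - 1) expR) => // [{}z _|].
    by apply: is_derive_eq; ring.
  by rewrite expR0 subrr.
have e2 (z : R) : `|z| <= 1 -> `|expR z - 1 - z| <= expR 1 * `|z| ^+ 2.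
  apply: (@bound_primitive (fun z => expR z - 1 - z) (fun z => expR z - 1)) => // [{}z _|].
    by apply: is_derive_eq; ring.
  by rewrite expR0 !subrr.
have e3 (z : R) : `|z| <= 1 -> `|expR z - 1 - z - 2^-1 * z ^+ 2| <= expR 1 * `|z| ^+ 3.
  apply: (@bound_primitive (fun z => expR z - 1 - z - 2^-1 * z ^+ 2)
    (fun z => expR z - 1 - z)) => // [{}z _|].
    by apply: is_derive_eq; rewrite /GRing.scale/=; field.
  by rewrite expR0 expr0n mulr0 !subrr.
apply: (@bound_primitive (fun z => expR z - 1 - (1 * z + 2^-1 * z ^+ 2 + 6^-1 * z ^+ 3))
  (fun z => expR z - 1 - z - 2^-1 * z ^+ 2)) => // [z _|].
  by apply: is_derive_eq; rewrite /GRing.scale/=; field.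
by rewrite expR0; ring.
Qed.

End Taylor.

(** * Expansions in [t], uniform for large [x] *)

Section Jets.
Variable R : realType.
Implicit Types (P Q : R -> R -> Prop) (f g : R -> R -> R) (a b c : R -> R).

(** In the application [x] is [|n|^2] and [t] its relative increment along a step to a neighbour. *)
Definition near2 P := exists X eta, 0 < eta /\ forall x t, X <= x -> `|t| <= eta -> P x t.

Lemma near2_and P Q : near2 P -> near2 Q -> near2 (fun x t => P x t /\ Q x t).
Proof.
move=> [X [eta [eta0 hP]]] [Y [eps [eps0 hQ]]].
exists (Num.max X Y), (Num.min eta eps); split; first by rewrite lt_min eta0.
by move=> x t; rewrite ge_max le_min => /andP[? ?] /andP[? ?]; split; [exact: hP|exact: hQ].
Qed.

Lemma near2_mono P Q : (forall x t, P x t -> Q x t) -> near2 P -> near2 Q.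
Proof.
by move=> PQ [X [eta [eta0 hP]]]; exists X, eta; split=> // x t Xx te; exact/PQ/hP.
Qed.

Lemma near2_all P : (forall x t, P x t) -> near2 P.
Proof. by move=> hP; exists 0, 1. Qed.

Definition bounded2 f := exists K, near2 (fun x t => `|f x t| <= K).

Lemma bounded2D f g : bounded2 f -> bounded2 g -> bounded2 (fun x t => f x t + g x t).
Proof.
move=> [K hK] [M hM]; exists (K + M).
by apply: near2_mono (near2_and hK hM) => x t [h1 h2]; apply: le_trans (ler_normD _ _) (lerD _ _).
Qed.

Lemma bounded2M f g : bounded2 f -> bounded2 g -> bounded2 (fun x t => f x t * g x t).
Proof.
move=> [K hK] [M hM]; exists (K * M).
by apply: near2_mono (near2_and hK hM) => x t [h1 h2]; rewrite normrM ler_pM.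
Qed.

Lemma bounded2_cst k : bounded2 (fun _ _ => k).
Proof. by exists `|k|; exact: near2_all. Qed.

Lemma bounded2_t : bounded2 (fun _ t => t).
Proof. by exists 1, 0, 1; split. Qed.

Lemma bounded2X f n : bounded2 f -> bounded2 (fun x t => f x t ^+ n).
Proof.
move=> hf; elim: n => [|n IH]; first exact: bounded2_cst.
by under eq_fun do under eq_fun do rewrite exprS; exact: bounded2M.
Qed.

(* Third order expansion of [f x t] in [t], uniform for [x] large; the cubic
   coefficient only needs to be bounded. *)
Definition jet f a b := exists c e,
  [/\ bounded2 (fun x _ => a x), bounded2 (fun x _ => b x), bounded2 (fun x _ => c x),
      bounded2 e &
      near2 (fun x t => f x t = a x * t + b x * t ^+ 2 + c x * t ^+ 3 + e x t * t ^+ 4)].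

Lemma jet_eq f g a b : near2 (fun x t => f x t = g x t) -> jet f a b -> jet g a b.
Proof.
move=> fg [c [e [ha hb hc he fE]]]; exists c, e; split=> //.
by apply: near2_mono (near2_and fg fE) => x t [<-].
Qed.

Lemma jet_id : jet (fun _ t => t) (fun=> 1) (fun=> 0).
Proof.
exists (fun=> 0), (fun _ _ => 0); split; try exact: bounded2_cst.
by apply: near2_all => x t; ring.
Qed.

Lemma jetD f g a b a' b' : jet f a b -> jet g a' b' ->
  jet (fun x t => f x t + g x t) (fun x => a x + a' x) (fun x => b x + b' x).
Proof.
move=> [c [e [ha hb hc he fE]]] [c' [e' [ha' hb' hc' he' gE]]].
exists (fun x => c x + c' x), (fun x t => e x t + e' x t); split; try exact: bounded2D.
by apply: near2_mono (near2_and fE gE) => x t [-> ->]; ring.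
Qed.

Lemma jetZ f a b s : bounded2 (fun x _ => s x) -> jet f a b ->
  jet (fun x t => s x * f x t) (fun x => s x * a x) (fun x => s x * b x).
Proof.
move=> hs [c [e [ha hb hc he fE]]].
exists (fun x => s x * c x), (fun x t => s x * e x t); split; try exact: bounded2M.
by apply: near2_mono fE => x t ->; ring.
Qed.

Lemma jet_comp (h : R -> R) (g1 g2 g3 : R) f a b : taylor3 h g1 g2 g3 -> jet f a b ->
  jet (fun x t => h (f x t)) (fun x => g1 * a x) (fun x => g1 * b x + g2 * a x ^+ 2).
Proof.
move=> [eta [K [eta0 hK]]] [c [e [ha hb hc he fE]]].
pose psi x t := b x + c x * t + e x t * t ^+ 2.
pose phi x t := a x + t * psi x t.
have bt := bounded2_t.
have cst := bounded2_cst.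
have hpsi : bounded2 psi.
  rewrite /psi; do 2 ?apply: bounded2D => //; apply: bounded2M => //; exact: bounded2X.
have hphi : bounded2 phi by rewrite /phi; apply: bounded2D => //; exact: bounded2M.
have fphi x t : a x * t + b x * t ^+ 2 + c x * t ^+ 3 + e x t * t ^+ 4 = t * phi x t.
  by rewrite /phi /psi; ring.
pose p z := g1 * z + g2 * z ^+ 2 + g3 * z ^+ 3.
pose r z := (h z - p z) / z ^+ 4.
have [M Mphi] := hphi.
have small : near2 (fun x t => `|f x t| <= eta).
  have : near2 (fun x t => `|t| <= eta / (`|M| + 1)).
    by exists 0, (eta / (`|M| + 1)); split=> //; rewrite divr_gt0// ltr_wpDl.
  move=> h'; apply: near2_mono (near2_and h' (near2_and fE Mphi)) => x t [te [-> ph]].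
  rewrite fphi normrM; have M1 : 0 < `|M| + 1 by rewrite ltr_wpDl.
  rewrite -[leRHS](divfK (lt0r_neq0 M1)) ler_pM//.
  by rewrite (le_trans ph)// (le_trans (ler_norm M))// lerDl.
(* At [z = 0] the quotient [r] is [0] by convention, and [h 0 = 0] follows from the bound itself. *)
have rE z : `|z| <= eta -> h z = p z + r z * z ^+ 4.
  move=> ze; have [z0|z0] := eqVneq z 0.
    have := hK z ze; rewrite -/(p z) z0 normr0 expr0n mulr0 normr_le0 subr_eq0 => /eqP ->.
    by rewrite mulr0 addr0.
  by rewrite /r divfK ?expf_neq0// addrC subrK.
have hr : bounded2 (fun x t => r (f x t)).
  exists `|K|; apply: near2_mono small => x t /hK; rewrite /r; set z := f x t => zK.
  have [->|z0] := eqVneq z 0; first by rewrite expr0n invr0 mulr0 normr0.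
  rewrite normrM normfV normrX ler_pdivrMr ?exprn_gt0 ?normr_gt0//.
  by apply: le_trans zK _; rewrite ler_wpM2r ?exprn_ge0// ler_norm.
exists (fun x => g1 * c x + g2 * 2 * a x * b x + g3 * a x ^+ 3).
exists (fun x t => g1 * e x t + g2 * (2 * a x * (c x + e x t * t) + psi x t ^+ 2) +
  g3 * (3 * a x ^+ 2 * psi x t + 3 * a x * t * psi x t ^+ 2 + t ^+ 2 * psi x t ^+ 3) +
  r (f x t) * phi x t ^+ 4).
split.
- by do ! [exact: cst | assumption | apply: bounded2D | apply: bounded2M | apply: bounded2X].
- by do ! [exact: cst | assumption | apply: bounded2D | apply: bounded2M | apply: bounded2X].
- by do ! [exact: cst | assumption | apply: bounded2D | apply: bounded2M | apply: bounded2X].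
- by do ! [exact: cst | assumption | apply: bounded2D | apply: bounded2M | apply: bounded2X].
apply: near2_mono (near2_and small fE) => x t [/rE -> fE'].
rewrite {1}/p; move: (r _) => rf; rewrite fE'; rewrite /phi /psi; ring.
Qed.

End Jets.

(** * Iterated logarithms *)

Section IteratedLogarithms.
Variable R : realType.
Implicit Types (x t r y : R).

Lemma iter_log_large k (M : R) : exists X, forall r, X <= r -> M <= iter_log k r.
Proof.
elim: k M => [|k IH] M; first by exists M.
have [X hX] := IH (expR M); exists X => r /hX Mr.
by rewrite /iter_log iterS -[M]expRK ler_ln// posrE ?expR_gt0// (lt_le_trans (expR_gt0 M)).
Qed.

Lemma iter_logS k r : iter_log k.+1 r = ln (iter_log k r).
Proof. by []. Qed.

Lemma ln_sqrt x : 0 < x -> ln (Num.sqrt x) = 2^-1 * ln x.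
Proof.
move=> x0; rewrite -[x in RHS]sqr_sqrtr ?ltW// lnXn ?sqrtr_gt0//.
by rewrite -[ln _ *+ 2]mulr_natl mulKf.
Qed.

Definition logprod k r : R := \prod_(1 <= j < k.+1) (1 / iter_log j r).

Lemma logprod0 r : logprod 0 r = 1.
Proof. by rewrite /logprod big_geq. Qed.

Lemma logprodS k r : logprod k.+1 r = logprod k r * (1 / iter_log k.+1 r).
Proof. by rewrite /logprod big_nat_recr. Qed.

Lemma near2_large (P : R -> Prop) : (exists X, forall r, X <= r -> P r) ->
  near2 (fun x t => P (Num.sqrt (x * (1 + t)))).
Proof.
(* [|t| <= 1/2] gives [x (1 + t) >= x / 2 >= X^2]. *)
move=> [X hX]; exists (2 * X ^+ 2), 2^-1; split; first by rewrite invr_gt0.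
move=> x t Xx; rewrite ler_norml => /andP[t1 _]; apply: hX.
have x0 : 0 <= x by apply: le_trans Xx; rewrite mulr_ge0// sqr_ge0.
have [X0|X0] := lerP 0 X; last by rewrite (le_trans (ltW X0))// sqrtr_ge0.
rewrite -[X]ger0_norm// -sqrtr_sqr ler_wsqrtr//.
by apply: (@le_trans _ _ (x * 2^-1)); [lra|rewrite ler_wpM2l//; lra].
Qed.

Lemma near2_large0 (P : R -> Prop) : (exists X, forall r, X <= r -> P r) ->
  near2 (fun x _ => P (Num.sqrt x)).
Proof.
move=> /near2_large[X [eta [eta0 h]]]; exists X, eta; split=> // x _ Xx _.
by have := h x 0 Xx; rewrite normr0 ltW// addr0 mulr1; apply.
Qed.

Lemma bounded2_invlog k : bounded2 (fun x _ => 1 / iter_log k (Num.sqrt x)).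
Proof.
exists 1; apply: near2_mono (near2_large0 (iter_log_large k 1)) => x _ L1.
by rewrite div1r normfV invf_le1 ?normr_gt0 ?gt_eqF ?(lt_le_trans _ L1)// ger0_norm ?(le_trans _ L1).
Qed.

Definition logdiff k x t : R :=
  iter_log k.+1 (Num.sqrt (x * (1 + t))) - iter_log k.+1 (Num.sqrt x).

(** Closed form of the recursion [b_(k+1) = l b_k - (l a_k)^2 / 2] produced by [ln (1 + z)], where
    [l = 1 / iter_log k.+1] and [a_k = logprod k / 2]. *)
Definition jet2_log k x : R :=
  - (logprod k (Num.sqrt x) / 8) * (1 + \sum_(0 <= i < k.+1) logprod i (Num.sqrt x)).

(** An increment of [ln L] is [ln (1 + (L' - L) / L)], so each logarithm composes the previous
    expansion with that of [ln (1 + z)]. *)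
Lemma jet_logdiff k :
  jet (logdiff k) (fun x => logprod k (Num.sqrt x) / 2) (jet2_log k).
Proof.
elim: k => [|k IH].
  have := jetZ (bounded2_cst (2^-1 : R)) (jet_comp (taylor3_ln1D R) (jet_id R)).
  have -> : (fun x : R => 2^-1 * (1 * 1)) = (fun x => logprod 0 (Num.sqrt x) / 2).
    by apply/funext => x; rewrite logprod0; field.
  have -> : (fun x : R => 2^-1 * (1 * 0 + - 2^-1 * 1 ^+ 2)) = jet2_log 0.
    by apply/funext => x; rewrite /jet2_log big_nat1 logprod0; field.
  apply: jet_eq; exists 1, 2^-1; split; first by rewrite invr_gt0.
  move=> x t x1; rewrite ler_norml => /andP[t1 _].
  have x0 : 0 < x by lra.
  have t0 : 0 < 1 + t by lra.
  rewrite /logdiff /iter_log /= !ln_sqrt// ?mulr_gt0// lnM ?posrE//; ring.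
have := jet_comp (taylor3_ln1D R) (jetZ (bounded2_invlog k.+1) IH).
have -> : (fun x : R => 1 * (1 / iter_log k.+1 (Num.sqrt x) * (logprod k (Num.sqrt x) / 2))) =
    (fun x => logprod k.+1 (Num.sqrt x) / 2).
  by apply/funext => x; rewrite logprodS; ring.
set b := (fun x => _ + _); have -> : b = jet2_log k.+1.
  apply/funext => x; rewrite /b /jet2_log [\sum_(0 <= i < k.+2) _]big_nat_recr// logprodS.
  by move: (1 / iter_log k.+1 _) (logprod k _) (\sum_(_ <= _ < _) _) => l p q /=; field.
apply: jet_eq.
have large := iter_log_large k.+1 1.
apply: near2_mono (near2_and (near2_large large) (near2_large0 large)) => x t [L1 L2].
rewrite /logdiff !(iter_logS k.+1).
have l1 := lt_le_trans ltr01 L1. have l2 := lt_le_trans ltr01 L2.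
rewrite -ln_div ?posrE//; congr ln.
by field; rewrite gt_eqF.
Qed.

End IteratedLogarithms.

(** * Radial functions *)

Section RadialFunctions.
Variables (R : realType) (d : nat).
Local Notation point := 'rV[int]_d.
Implicit Types (n : point) (p : 'I_d * bool).

Lemma sum_steps (F : 'I_d * bool -> R) :
  \sum_p F p = \sum_(i < d) (F (i, true) + F (i, false)).
Proof.
rewrite (eq_bigr (fun p => F (p.1, p.2))); last by case.
rewrite -(pair_bigA _ (fun i b => F (i, b)))/=.
by apply: eq_bigr => i _; rewrite big_bool.
Qed.

(** The relative increment of [|n|^2] rather than of [|n|], because it is a polynomial in the
    coordinates divided by [|n|^2]. *)
Definition step_ratio n p : R :=
  (2 * (-1) ^+ p.2 * (n ord0 p.1)%:~R + 1) / znorm R n ^+ 2.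

Lemma znorm_add_step n p : znorm R n != 0 ->
  znorm R (n + step p) = Num.sqrt (znorm R n ^+ 2 * (1 + step_ratio n p)).
Proof.
move=> n0; rewrite /znorm; congr Num.sqrt; rewrite -/(znorm R n).
rewrite mulrDr mulr1 /step_ratio mulrC divfK ?expf_neq0// znorm_sq.
rewrite (bigD1 p.1)//= [in RHS](bigD1 p.1)//= mxE stepE eqxx.
under eq_bigr => i ip do rewrite mxE stepE (negbTE ip) addr0.
by rewrite rmorphD/=; case: p.2; rewrite ?expr1 ?expr0 ?rmorphN rmorph1/=; ring.
Qed.

Lemma step_ratio_sq n p : 1 <= znorm R n ^+ 2 ->
  step_ratio n p ^+ 2 <= 10 / znorm R n ^+ 2.
Proof.
move=> n1; have n0 := lt_le_trans ltr01 n1.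
rewrite /step_ratio expr_div_n ler_pdivrMr; last exact: exprn_gt0.
rewrite [leRHS](_ : _ = 10 * znorm R n ^+ 2); last by field; rewrite -sqrf_eq0 gt_eqF.
have := coord_le_znorm R n p.1.
rewrite -ler_sqr ?nnegrE ?znorm_ge0 ?normr_ge0// -normrX ger0_norm ?sqr_ge0//.
(* The numerator squared is at most [8 m^2 + 2], with [m^2 <= x] and [1 <= x]. *)
move: n1; move: (znorm R n ^+ 2) ((n ord0 p.1)%:~R : R) => x m x1 mx.
by case: p.2; rewrite ?expr1 ?expr0; nra.
Qed.

(** Each ratio is only [O(x^(-1/2))], but opposite steps cancel the odd leading parts: the first two
    moments are of order [1 / x], the third and fourth [O(1 / x^2)]. Hence the cubic coefficient
    enters only through its bound. *)
Lemma jet_step_sum (f : R -> R -> R) (a b : R -> R) : jet f a b ->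
  exists K X, forall n, X <= znorm R n ^+ 2 ->
   `|\sum_p f (znorm R n ^+ 2) (step_ratio n p)
     - (2 * d%:R * a (znorm R n ^+ 2) + 8 * b (znorm R n ^+ 2)) / znorm R n ^+ 2|
   <= K / znorm R n ^+ 2 ^+ 2.
Proof.
move=> [c [e [_ [Kb hb] [Kc hc] [Ke he] fE]]].
have [X [eta [eta0 H]]] := near2_and hb (near2_and hc (near2_and he fE)).
exists (2 * d%:R * Kb + (24 + 2 * d%:R) * Kc + 200 * d%:R * Ke).
exists (Num.max X (Num.max 1 (10 / eta ^+ 2))) => n.
rewrite !ge_max => /and3P[Xn n1 etan].
have n0 := lt_le_trans ltr01 n1.
have tsq p := step_ratio_sq p n1.
set x := znorm R n ^+ 2 in Xn n1 etan n0 tsq *.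
have teta p : `|step_ratio n p| <= eta.
  rewrite -ler_sqr ?nnegrE ?(ltW eta0)// -normrX ger0_norm ?sqr_ge0//.
  apply: le_trans (tsq p) _; rewrite ler_pdivrMr// mulrC -ler_pdivrMr//.
  by rewrite exprn_gt0.
have t4 p : step_ratio n p ^+ 4 <= 100 / x ^+ 2.
  rewrite (_ : 4 = 2 * 2)%N// exprM (_ : 100 / _ = (10 / x) ^+ 2); last by field; rewrite gt_eqF.
  by rewrite lerXn2r ?nnegrE ?sqr_ge0// divr_ge0// ltW.
have [bK [cK _]] : `|b x| <= Kb /\ `|c x| <= Kc /\ True.
  by have := H x 0 Xn; rewrite normr0 ltW// => /(_ isT)[? []].
have sum1 : \sum_p step_ratio n p = 2 * d%:R / x.
  rewrite sum_steps (eq_bigr (fun=> 2 / x)) => [|i _].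
    by rewrite sumr_const card_ord -mulr_natl; ring.
  by rewrite /step_ratio/= -/x; field; rewrite gt_eqF.
have sum2 : \sum_p step_ratio n p ^+ 2 = 8 / x + 2 * d%:R / x ^+ 2.
  rewrite sum_steps (eq_bigr (fun i => 8 / x ^+ 2 * (n ord0 i)%:~R ^+ 2 + 2 / x ^+ 2)) => [|i _].
    rewrite big_split/= -mulr_sumr -znorm_sq -/x sumr_const card_ord -mulr_natl.
    by field; rewrite gt_eqF.
  by rewrite /step_ratio/= -/x; field; rewrite gt_eqF.
have sum3 : \sum_p step_ratio n p ^+ 3 = 24 / x ^+ 2 + 2 * d%:R / x ^+ 3.
  rewrite sum_steps (eq_bigr (fun i => 24 / x ^+ 3 * (n ord0 i)%:~R ^+ 2 + 2 / x ^+ 3)) => [|i _].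
    rewrite big_split/= -mulr_sumr -znorm_sq -/x sumr_const card_ord -mulr_natl.
    by field; rewrite gt_eqF.
  by rewrite /step_ratio/= -/x; field; rewrite gt_eqF.
have sum4 : `|\sum_p e x (step_ratio n p) * step_ratio n p ^+ 4| <= 200 * d%:R * Ke / x ^+ 2.
  apply: le_trans (ler_norm_sum _ _ _) _.
  apply: (@le_trans _ _ (\sum_(p : 'I_d * bool) Ke * (100 / x ^+ 2))).
    apply: ler_sum => p _; rewrite normrM ler_pM//.
      by have [_ [_ []]] := H _ _ Xn (teta p).
    by rewrite ger0_norm// (_ : 4 = 2 * 2)%N// exprM sqr_ge0.
  by rewrite sumr_const card_prod card_ord card_bool -[_ *+ (d * 2)]mulr_natl natrM; lra.
have -> : \sum_p f x (step_ratio n p) = a x * (2 * d%:R / x) +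
    b x * (8 / x + 2 * d%:R / x ^+ 2) + c x * (24 / x ^+ 2 + 2 * d%:R / x ^+ 3) +
    \sum_p e x (step_ratio n p) * step_ratio n p ^+ 4.
  rewrite -sum1 -sum2 -sum3 !mulr_sumr -!big_split/=; apply: eq_bigr => p _.
  by have [_ [_ [_ ->]]] := H _ _ Xn (teta p).
set S := \sum_p _ in sum4 *.
have -> : a x * (2 * d%:R / x) + b x * (8 / x + 2 * d%:R / x ^+ 2) +
    c x * (24 / x ^+ 2 + 2 * d%:R / x ^+ 3) + S - (2 * d%:R * a x + 8 * b x) / x =
    b x * (2 * d%:R / x ^+ 2) + c x * ((24 + 2 * d%:R / x) / x ^+ 2) + S.
  by field; rewrite gt_eqF.
have d0 : 0 <= d%:R :> R by [].
have x2 : 0 < x ^+ 2 by rewrite exprn_gt0.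
rewrite [leRHS](_ : _ = Kb * (2 * d%:R / x ^+ 2) + Kc * ((24 + 2 * d%:R) / x ^+ 2) +
  200 * d%:R * Ke / x ^+ 2); last by ring.
apply: le_trans (ler_normD _ _) (lerD _ sum4).
apply: le_trans (ler_normD _ _) (lerD _ _); rewrite normrM.
  have dx2 : 0 <= 2 * d%:R / x ^+ 2 by apply: divr_ge0; [exact: mulr_ge0|exact: ltW].
  by rewrite (ger0_norm dx2) ler_wpM2r.
have dx : 0 <= 2 * d%:R / x by apply: divr_ge0; [exact: mulr_ge0|exact: ltW].
rewrite ler_pM// ger0_norm; last by apply: divr_ge0; [exact: addr_ge0|exact: ltW].
by rewrite ler_pM2r ?invr_gt0// lerD2l ler_pdivrMr// ler_peMr// mulr_ge0.
Qed.

(** Minus the logarithm of [r^(-c0) (log_1 r ... log_s r)^(-1/2)]; in this form the expansions of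
    the iterated logarithms simply add up. *)
Definition logexp (c0 : R) s r : R :=
  c0 * iter_log 1 r + 2^-1 * \sum_(1 <= k < s.+1) iter_log k.+1 r.

Definition radial c0 s n : R := expR (- logexp c0 s (znorm R n)).

Lemma radial_gt0 c0 s n : 0 < radial c0 s n.
Proof. exact: expR_gt0. Qed.

Definition radial_jet1 c0 s x : R := c0 * (logprod 0 (Num.sqrt x) / 2) +
  2^-1 * \sum_(1 <= k < s.+1) (logprod k (Num.sqrt x) / 2).

Definition radial_jet2 c0 s x : R := c0 * jet2_log 0 x + 2^-1 * \sum_(1 <= k < s.+1) jet2_log k x.

Lemma jet_sum (f : nat -> R -> R -> R) (a b : nat -> R -> R) s :
  (forall k, jet (f k) (a k) (b k)) ->
  jet (fun x t => \sum_(1 <= k < s.+1) f k x t) (fun x => \sum_(1 <= k < s.+1) a k x)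
      (fun x => \sum_(1 <= k < s.+1) b k x).
Proof.
move=> h; elim: s => [|s IH].
  have E (u : nat -> R -> R) : (fun x => \sum_(1 <= k < 1) u k x) = (fun=> 0).
    by apply/funext => x; rewrite big_geq.
  rewrite !E; exists (fun=> 0), (fun _ _ => 0); split; try exact: bounded2_cst.
  by apply: near2_all => x t; rewrite big_geq//; ring.
have E (u : nat -> R -> R) : (fun x => \sum_(1 <= k < s.+2) u k x) =
    (fun x => \sum_(1 <= k < s.+1) u k x + u s.+1 x).
  by apply/funext => x; rewrite big_nat_recr.
rewrite !E; apply: jet_eq (jetD IH (h s.+1)).
by apply: near2_all => x t; rewrite [RHS]big_nat_recr.
Qed.

Lemma jet_radial c0 s :
  jet (fun x t => expR (- (logexp c0 s (Num.sqrt (x * (1 + t))) - logexp c0 s (Num.sqrt x))) - 1)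
    (fun x => - radial_jet1 c0 s x) (fun x => radial_jet1 c0 s x ^+ 2 / 2 - radial_jet2 c0 s x).
Proof.
have := jet_comp (taylor3_expRB1 R) (jetZ (bounded2_cst (-1)) (jetD
  (jetZ (bounded2_cst c0) (jet_logdiff R 0))
  (jetZ (bounded2_cst 2^-1) (jet_sum s (@jet_logdiff R))))).
congr (jet _ _ _); apply/funext => x.
- apply/funext => t; congr (expR _ - 1).
  by rewrite /logexp /logdiff sumrB; ring.
- by rewrite /radial_jet1; ring.
- by rewrite /radial_jet1 /radial_jet2; field.
Qed.

Lemma lap_radial c0 s n : znorm R n != 0 ->
  lap (radial c0 s) n = - radial c0 s n * \sum_p
    (expR (- (logexp c0 s (Num.sqrt (znorm R n ^+ 2 * (1 + step_ratio n p)))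
              - logexp c0 s (Num.sqrt (znorm R n ^+ 2)))) - 1).
Proof.
move=> n0; rewrite /lap mulr_sumr; apply: eq_bigr => p _.
rewrite -znorm_add_step// sqrtr_sqr ger0_norm ?znorm_ge0//.
rewrite [RHS](_ : _ = radial c0 s n - radial c0 s n *
  expR (- (logexp c0 s (znorm R (n + step p)) - logexp c0 s (znorm R n)))); last by ring.
by congr (_ - _); rewrite /radial -expRD; congr expR; ring.
Qed.

(** The sum of products over [i <= k] is half the square of the full sum plus half its diagonal. *)
Lemma sum_logprod s (r : R) :
  \sum_(1 <= k < s.+1) logprod k r * (1 + \sum_(0 <= i < k.+1) logprod i r) =
  2 * (\sum_(1 <= k < s.+1) logprod k r) +
  ((\sum_(1 <= k < s.+1) logprod k r) ^+ 2 + \sum_(1 <= k < s.+1) logprod k r ^+ 2) / 2.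
Proof.
have split0 k : \sum_(0 <= i < k.+1) logprod i r = 1 + \sum_(1 <= i < k.+1) logprod i r.
  by rewrite big_ltn// logprod0.
elim: s => [|s IH]; first by rewrite !big_geq//; field.
rewrite big_nat_recr//= IH split0 !(big_nat_recr s.+1)//=.
by field.
Qed.

(** The right side is [r^2] times the continuous Laplacian of the radial function, divided by that
    function. *)
Lemma jet_radialE c0 s x : let r := Num.sqrt x in
  2 * d%:R * (- radial_jet1 c0 s x) + 8 * (radial_jet1 c0 s x ^+ 2 / 2 - radial_jet2 c0 s x) =
  c0 * (c0 + 2 - d%:R) + (c0 + 1 - d%:R / 2) * (\sum_(1 <= k < s.+1) logprod k r) +
  ((\sum_(1 <= k < s.+1) logprod k r) ^+ 2 * 2 + \sum_(1 <= k < s.+1) logprod k r ^+ 2) / 4.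
Proof.
move=> r; rewrite /radial_jet1 /radial_jet2 -/r -mulr_suml.
have -> : jet2_log 0 x = - 4^-1 by rewrite /jet2_log big_nat1 logprod0; field.
have -> : \sum_(1 <= k < s.+1) jet2_log k x = - 8^-1 * \sum_(1 <= k < s.+1)
    logprod k r * (1 + \sum_(0 <= i < k.+1) logprod i r).
  by rewrite mulr_sumr; apply: eq_bigr => k _; rewrite /jet2_log -/r; ring.
by rewrite sum_logprod logprod0; field.
Qed.

End RadialFunctions.

(** * Radial sub- and supersolutions *)

Section Barriers.
Variables (R : realType) (d : nat).
Local Notation point := 'rV[int]_d.
Implicit Types (n : point).

Lemma iter_logs_large s (M : R) :
  exists X, forall r, X <= r -> forall k, (k <= s)%N -> M <= iter_log k r.
Proof.
elim: s => [|s [X hX]].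
  by exists M => r rM k; rewrite leqn0 => /eqP ->.
have [Y hY] := iter_log_large s.+1 M; exists (Num.max X Y) => r.
by rewrite ge_max => /andP[Xr Yr] k; rewrite leq_eqVlt ltnS => /predU1P[->|/hX]; auto.
Qed.

Lemma logprod_ge0 s (r : R) k : (forall j, (j <= s)%N -> 1 <= iter_log j r) ->
  (k <= s)%N -> 0 <= logprod k r.
Proof.
move=> L1 ks; rewrite /logprod big_seq prodr_ge0// => j.
rewrite mem_index_iota => /andP[_]; rewrite ltnS => jk.
by rewrite divr_ge0// (le_trans ler01)// L1// (leq_trans jk).
Qed.

Definition critical s n : R := d%:R * (4 - d%:R) / (4 * znorm R n ^+ 2)
  + 1 / znorm R n ^+ 2 *
    \sum_(1 <= j < s.+1) \prod_(1 <= k < j.+1) (1 / iter_log k (znorm R n)).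

Lemma criticalE s n : znorm R n != 0 -> critical s n =
  (d%:R * (4 - d%:R) / 4 + \sum_(1 <= k < s.+1) logprod k (znorm R n)) / znorm R n ^+ 2.
Proof. by move=> n0; rewrite /critical /logprod; field. Qed.

Definition radial_coeff (c0 : R) s (r : R) : R := c0 * (c0 + 2 - d%:R) +
  (c0 + 1 - d%:R / 2) * (\sum_(1 <= k < s.+1) logprod k r) +
  ((\sum_(1 <= k < s.+1) logprod k r) ^+ 2 * 2 + \sum_(1 <= k < s.+1) logprod k r ^+ 2) / 4.

Lemma hop_radial c0 s : exists K X, 0 <= K /\ forall W n, X <= znorm R n ->
  `|hop W (radial c0 s) n
    - radial c0 s n * (W n - radial_coeff c0 s (znorm R n) / znorm R n ^+ 2)|
    <= radial c0 s n * (K / znorm R n ^+ 2 ^+ 2).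
Proof.
have [K [X H]] := jet_step_sum d (jet_radial c0 s).
exists `|K|, (Num.max 1 X); split=> // W n; rewrite ge_max => /andP[n1 nX].
have n0 : 0 < znorm R n by apply: lt_le_trans n1.
have /H : X <= znorm R n ^+ 2 by rewrite (le_trans nX)// expr2 ler_peMr// ltW.
rewrite jet_radialE sqrtr_sqr (ger0_norm (znorm_ge0 R n)) -/(radial_coeff _ _ _).
set F := radial_coeff _ _ _.
rewrite /hop lap_radial ?gt_eqF// sqrtr_sqr (ger0_norm (znorm_ge0 R n)).
set S := \sum_p _ => HS.
rewrite (_ : _ - _ = - (radial c0 s n * (S - F / znorm R n ^+ 2))); last by ring.
rewrite normrN normrM gtr0_norm ?radial_gt0// ler_pM2l ?radial_gt0//.
by apply: le_trans HS _; rewrite ler_wpM2r ?ler_norm// invr_ge0 sqr_ge0.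
Qed.

Lemma ln_sq_le (r : R) : 1 <= r -> ln r ^+ 2 <= 4 * r.
Proof.
move=> r1; have r0 : 0 < r by apply: lt_le_trans r1.
have sr0 : 0 < Num.sqrt r by rewrite sqrtr_gt0.
have := ln_sublinear sr0; rewrite ln_sqrt// => h.
have l0 : 0 <= ln r by rewrite ln_ge0.
have -> : 4 * r = (2 * Num.sqrt r) ^+ 2 by rewrite exprMn sqr_sqrtr ?ltW//; ring.
by rewrite lerXn2r ?nnegrE ?mulr_ge0 ?sqrtr_ge0//; lra.
Qed.

(** At [c0 = d/2] the constant part of [radial_coeff] is [d (4 - d) / 4] and its linear part has
    coefficient [1], so [critical] cancels both and the quadratic part is left with a negative
    sign. *)
Lemma subsolution s : exists X, forall n, X <= znorm R n ->
  hop (critical s.+1) (radial (d%:R / 2) s.+1) n < 0.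
Proof.
have [K [X [K0 H]]] := hop_radial (d%:R / 2) s.+1.
have [Y hY] := iter_logs_large s.+1 1.
(* The gain is at least [1 / (2 ln^2 r)], and [2 K ln^2 r <= 8 K r < r^2]. *)
exists (Num.max (Num.max 1 (8 * K + 1)) (Num.max X Y)) => n.
rewrite !ge_max => /andP[/andP[n1 nK] /andP[nX nY]].
have {}hY := hY _ nY.
have n0 : 0 < znorm R n by apply: lt_le_trans n1.
have lnsq := ln_sq_le n1.
have := H (critical s.+1) n nX; rewrite criticalE ?gt_eqF// /radial_coeff.
set r := znorm R n in n1 nK hY n0 lnsq *.
have P1 : logprod 1 r = 1 / ln r by rewrite /logprod big_nat1.
have T1 : logprod 1 r <= \sum_(1 <= k < s.+2) logprod k r.
  rewrite big_ltn// lerDl big_seq sumr_ge0// => k.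
  by rewrite mem_index_iota => /andP[_]; exact: (logprod_ge0 hY).
have Q1 : 0 <= \sum_(1 <= k < s.+2) logprod k r ^+ 2.
  by apply: sumr_ge0 => k _; exact: sqr_ge0.
have ln1 : 1 <= ln r by exact: (hY 1%N).
rewrite P1 in T1.
move: T1 Q1; set T := \sum_(1 <= k < s.+2) _; set Q := \sum_(1 <= k < s.+2) _ => T1 Q1.
set w := radial _ _ n; have w0 : 0 < w by exact: radial_gt0.
move=> /ler_normlP[_]; rewrite lerBlDr => /le_lt_trans; apply.
rewrite -mulrDr pmulr_rlt0//.
have gain : K / r ^+ 2 < (T ^+ 2 * 2 + Q) / 4.
  have l0 : 0 < ln r by apply: lt_le_trans ln1.
  apply: (@lt_le_trans _ _ ((1 / ln r) ^+ 2 / 2)).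
    rewrite expr_div_n expr1n -mulrA mul1r -invfM ltr_pdivrMr ?exprn_gt0//.
    by rewrite mulrC ltr_pdivlMr ?mulr_gt0 ?exprn_gt0//; nra.
  have iL : 0 <= 1 / ln r by rewrite divr_ge0// ltW.
  have : (1 / ln r) ^+ 2 <= T ^+ 2 by rewrite lerXn2r// nnegrE// (le_trans iL).
  lra.
have r2 : 0 < r ^+ 2 by rewrite exprn_gt0.
rewrite (_ : K / r ^+ 2 ^+ 2 + _ = (K / r ^+ 2 - (T ^+ 2 * 2 + Q) / 4) / r ^+ 2).
  by rewrite pmulr_llt0 ?invr_gt0// subr_lt0.
by field; rewrite gt_eqF.
Qed.

(** At [c0 = d/2 - 1] the constant part is [d (4 - d) / 4 - 1]: the surplus [1 / r^2] absorbs the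
    error of order [1 / r^4]. *)
Lemma supersolution s : exists X, forall n, X <= znorm R n ->
  0 <= hop (critical s.+1) (radial (d%:R / 2 - 1) 0) n.
Proof.
have [K [X [K0 H]]] := hop_radial (d%:R / 2 - 1) 0.
have [Y hY] := iter_logs_large s.+1 1.
exists (Num.max (Num.max 1 K) (Num.max X Y)) => n.
rewrite !ge_max => /andP[/andP[n1 nK] /andP[nX nY]].
have {}hY := hY _ nY.
have n0 : 0 < znorm R n by apply: lt_le_trans n1.
have := H (critical s.+1) n nX; rewrite criticalE ?gt_eqF// /radial_coeff !(big_geq (leqnn 1))//.
set r := znorm R n in n1 nK hY n0 *.
have T0 : 0 <= \sum_(1 <= k < s.+2) logprod k r.
  rewrite big_seq sumr_ge0// => k.
  by rewrite mem_index_iota => /andP[_]; exact: (logprod_ge0 hY).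
set T := \sum_(1 <= k < s.+2) _ in T0 *.
set w := radial _ _ n; have w0 : 0 < w by exact: radial_gt0.
have r2 : 0 < r ^+ 2 by rewrite exprn_gt0.
move=> /ler_normlP[+ _]; rewrite lerNl lerBrDr -mulrN -mulrDr; apply: le_trans.
rewrite mulr_ge0 ?(ltW w0)//.
rewrite [leRHS](_ : _ = (1 + T - K / r ^+ 2) / r ^+ 2); last by field; rewrite gt_eqF.
apply: divr_ge0; last exact: ltW.
rewrite subr_ge0 ler_pdivrMr//.
by rewrite expr2; nra.
Qed.

Lemma radial_ratio s : exists X, forall e, 0 < e -> forall n,
  e * radial (d%:R / 2 - 1) 0 n < radial (d%:R / 2) s n -> znorm R n <= Num.max X e^-1.
Proof.
have [X hX] := iter_logs_large s.+1 0.
exists (Num.max 1 X) => e e0 n; rewrite leNgt => h; apply/negP.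
rewrite !gt_max => /andP[/andP[n1 /ltW /hX L0] ne].
have n0 : 0 < znorm R n by apply: lt_trans n1.
move: h; rewrite ltNge => /negP; apply.
have -> : radial (d%:R / 2) s n = radial (d%:R / 2 - 1) 0 n *
    expR (- (ln (znorm R n) + 2^-1 * \sum_(1 <= k < s.+1) iter_log k.+1 (znorm R n))).
  rewrite /radial -expRD /logexp (big_geq (leqnn 1)); congr expR; rewrite /iter_log/=.
  by ring.
rewrite mulrC ler_pM2r ?radial_gt0//.
apply: (@le_trans _ _ (znorm R n)^-1); last by rewrite invf_ple ?posrE// ltW.
rewrite -[leRHS]lnK ?posrE ?invr_gt0// ler_expR lnV ?posrE// lerN2 lerDl mulr_ge0//.
rewrite big_seq sumr_ge0// => k; rewrite mem_index_iota => /andP[_ ks]; exact: L0.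
Qed.

End Barriers.

(** * Divergence *)

Section Divergence.
Variable R : realType.

Lemma le_sum_total (T : choiceType) (f : T -> R) (s : seq T) : uniq s ->
  (forall i, 0 <= f i) -> abs_summable f -> \sum_(i <- s) f i <= total f.
Proof.
move=> us f0 fs; rewrite -lee_fin -total_fine// -sumEFin; apply: esum_ge.
by exists [set` s]; [split=> //; exact: finite_seq|rewrite -fsbig_seq].
Qed.

Lemma ln_increment (a b : R) : 0 < a -> 0 < b -> ln b - ln a <= (b - a) / a.
Proof.
move=> a0 b0; rewrite -ln_div ?posrE// (_ : b / a = 1 + (b - a) / a).
  by apply: le_ln1Dx; rewrite mulrBl divff ?gt_eqF// ltrBrDr addNr divr_gt0.
by field; rewrite gt_eqF.
Qed.

(** Stands in for the integral test: terms of the Bertrand series dominate increments of an iterated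
    logarithm, by iterating [ln (1 + z) <= z]. *)
Lemma iter_log_increment s (a b : R) :
  (forall k, (k <= s)%N -> 1 <= iter_log k a) ->
  (forall k, (k <= s)%N -> 1 <= iter_log k b) ->
  iter_log s.+1 b - iter_log s.+1 a <= (b - a) / a * logprod s a.
Proof.
elim: s => [|s IH] ha hb.
  by rewrite logprod0 mulr1; apply: ln_increment; apply: lt_le_trans ltr01 _; [exact: (ha 0%N)|exact: (hb 0%N)].
have La := lt_le_trans ltr01 (ha s.+1 (leqnn _)).
have Lb := lt_le_trans ltr01 (hb s.+1 (leqnn _)).
rewrite (iter_logS s.+1 b) (iter_logS s.+1 a).
apply: le_trans (ln_increment La Lb) _.
rewrite logprodS mulrA mul1r ler_pM2r ?invr_gt0//.
by apply: IH => k ks; [apply: ha|apply: hb]; exact: leqW.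
Qed.

Variable d : nat.
Local Notation point := 'rV[int]_(d.+1).

(** These [N^d] points in dimension [d.+1] have norm comparable to [N] and are distinct for distinct
    [N]: a part of each shell large enough for divergence. *)
Definition face_point N (v : {ffun 'I_d -> 'I_N}) : point :=
  \row_i (if unlift ord0 i is Some j then (v j : nat)%:Z else N%:Z).

Lemma face_point0 N v : @face_point N v ord0 ord0 = N%:Z.
Proof. by rewrite mxE unlift_none. Qed.

Lemma face_point_lift N v j : @face_point N v ord0 (lift ord0 j) = (v j : nat)%:Z.
Proof. by rewrite mxE liftK. Qed.

Lemma face_point_inj N : injective (@face_point N).
Proof.
move=> v w /rowP E; apply/ffunP => j; apply/val_inj.
by have := E (lift ord0 j); rewrite !face_point_lift => -[].
Qed.

Lemma znorm_face_point N v :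
  N%:R <= znorm R (@face_point N v) <= d.+1%:R * N%:R.
Proof.
apply/andP; split.
  have := coord_le_znorm R (face_point v) ord0.
  by rewrite face_point0 -pmulrn ger0_norm.
rewrite -(@ler_pXn2r _ 2) ?nnegrE ?znorm_ge0 ?mulr_ge0// znorm_sq.
apply: (@le_trans _ _ (\sum_(i < d.+1) N%:R ^+ 2)).
  apply: ler_sum => i _; rewrite mxE; case: unliftP => [j _|_]//.
  by rewrite -!pmulrn lerXn2r ?nnegrE// ler_nat ltnW.
rewrite sumr_const card_ord -[_ *+ d.+1]mulr_natl exprMn ler_wpM2r ?sqr_ge0//.
by rewrite -natrX ler_nat expnS expn1 leq_pmulr.
Qed.

Definition face_points N0 M : seq point :=
  [seq @face_point N v | N <- index_iota N0 M, v <- index_enum {ffun 'I_d -> 'I_N}].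

Lemma face_points_uniq N0 M : uniq (face_points N0 M).
Proof.
apply: allpairs_uniq_dep => [|N _|]; [exact: iota_uniq|exact: index_enum_uniq|].
move=> [N v] [N' w] _ _ /= E.
have NN : N = N'.
  by have := congr1 (fun n : point => n ord0 ord0) E; rewrite !face_point0 => -[].
by case: N' / NN w E => w /face_point_inj ->.
Qed.

Lemma expR_logexp_sq s (r : R) : (forall k, (k <= s)%N -> 1 <= iter_log k r) ->
  expR (- logexp (d.+1%:R / 2) s r) ^+ 2 = (r ^+ d.+1)^-1 * logprod s r.
Proof.
move=> L1; rewrite /logexp.
have r0 : 0 < r by apply: lt_le_trans ltr01 (L1 0%N _).
have L : logprod s r = expR (- \sum_(1 <= k < s.+1) iter_log k.+1 r).
  elim: s L1 => [|s IH] L1; first by rewrite logprod0 big_geq// oppr0 expR0.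
  rewrite logprodS IH => [|k ks]; last by apply: L1; exact: leqW.
  have -> : \sum_(1 <= k < s.+2) iter_log k.+1 r =
      \sum_(1 <= k < s.+1) iter_log k.+1 r + iter_log s.+2 r by rewrite big_nat_recr.
  rewrite opprD expRD; congr (_ * _).
  rewrite expRN (iter_logS s.+1) lnK ?div1r// posrE.
  exact: lt_le_trans ltr01 (L1 _ (leqnn _)).
have -> : (r ^+ d.+1)^-1 = expR (- (d.+1%:R * ln r)).
  by rewrite expRN mulr_natl -lnXn// lnK// posrE exprn_gt0.
rewrite L -expRD expr2 -expRD; congr expR; rewrite /iter_log/=.
by field.
Qed.

Lemma logexp_le c0 s (a b : R) : 0 <= c0 -> a <= b ->
  (forall k, (k <= s)%N -> 1 <= iter_log k a) -> logexp c0 s a <= logexp c0 s b.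
Proof.
move=> c00 ab L1.
have mono k : (k <= s.+1)%N -> iter_log k a <= iter_log k b.
  elim: k => [//|k IH] ks; rewrite !iter_logS ler_ln ?posrE ?IH 1?ltnW//.
    exact: lt_le_trans ltr01 (L1 _ ks).
  by apply: lt_le_trans (IH (ltnW ks)); exact: lt_le_trans ltr01 (L1 _ ks).
rewrite /logexp lerD ?ler_wpM2l ?mono//.
by apply: ler_sum_nat => k /andP[_ ks]; exact: mono.
Qed.

(** The radial function decreases, so each point contributes at least the value at radius [(d+1) N];
    the [N^d] points together give a multiple of [logprod s / N], which bounds the increment. *)
Lemma face_sum_ge s N : (0 < N)%N ->
    (forall k, (k <= s)%N -> 1 <= iter_log k (N%:R : R)) ->
    (forall k, (k <= s)%N -> 1 <= iter_log k (d.+1%:R * N%:R : R)) ->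
    (forall k, (k <= s)%N -> 1 <= iter_log k (d.+1%:R * N.+1%:R : R)) ->
  (d.+1%:R ^+ d.+1)^-1 *
    (iter_log s.+1 (d.+1%:R * N.+1%:R) - iter_log s.+1 (d.+1%:R * N%:R)) <=
  \sum_(v : {ffun 'I_d -> 'I_N}) radial (d.+1%:R / 2) s (face_point v) ^+ 2 :> R.
Proof.
move=> N0 hN hD hD'.
apply: (@le_trans _ _ (\sum_(v : {ffun 'I_d -> 'I_N})
    expR (- logexp (d.+1%:R / 2) s (d.+1%:R * N%:R)) ^+ 2)); last first.
  apply: ler_sum => v _; rewrite lerXn2r ?nnegrE ?expR_ge0// ler_expR lerN2.
  have /andP[lo hi] := znorm_face_point v.
  apply: logexp_le => // k ks.
  have mono j : (j <= s)%N -> iter_log j (N%:R : R) <= iter_log j (znorm R (face_point v)).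
    elim: j => [//|j IH] js; rewrite !iter_logS ler_ln ?posrE ?IH 1?ltnW//.
      exact: lt_le_trans ltr01 (hN _ (ltnW js)).
    by apply: lt_le_trans (IH (ltnW js)); exact: lt_le_trans ltr01 (hN _ (ltnW js)).
  exact: le_trans (hN _ ks) (mono _ ks).
rewrite expR_logexp_sq// sumr_const card_ffun !card_ord.
have N0' : 0 < N%:R :> R by rewrite ltr0n.
have D0 : 0 < d.+1%:R :> R by rewrite ltr0n.
rewrite [leRHS](_ : _ = (d.+1%:R ^+ d.+1)^-1 * (N%:R^-1 * logprod s (d.+1%:R * N%:R))).
  rewrite ler_pM2l ?invr_gt0 ?exprn_gt0//.
  apply: le_trans (iter_log_increment hD hD') _.
  rewrite (_ : (_ - _) / _ = N%:R^-1)// -natr1; field.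
  by rewrite !gt_eqF.
rewrite -[_ *+ _]mulr_natl natrX exprMn [N%:R ^+ d.+1]exprS; field.
by rewrite !expf_neq0 ?gt_eqF.
Qed.

(** The face sums telescope to an iterated logarithm, which is unbounded, while domination would
    bound them by the sum of [C^2 u^2]. *)
Lemma radial_not_dominated s (u : point -> R) C : l2r u ->
  ~ (forall n, radial (d.+1%:R / 2) s n <= C * u n).
Proof.
move=> u2 wu.
have [X hX] := iter_logs_large s.+1 (1 : R).
have bnd (Y : R) : exists N : nat, Y <= N%:R.
  exists (Num.Def.archi_bound `|Y|); apply: le_trans (ler_norm Y) _.
  exact/ltW/archi_boundP.
have [N1 XN1] := bnd X; pose N0 := N1.+1.
have large N : (N0 <= N)%N -> X <= N%:R :> R.
  by move=> NN; apply: le_trans XN1 _; rewrite ler_nat ltnW.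
have largeD N : (N0 <= N)%N -> X <= d.+1%:R * N%:R :> R.
  by move=> NN; apply: le_trans (large _ NN) _; rewrite ler_peMl// ler1n.
pose q N : R := iter_log s.+1 (d.+1%:R * N%:R).
have k0 : 0 < (d.+1%:R ^+ d.+1)^-1 :> R by rewrite invr_gt0 exprn_gt0.
have key M : (N0 <= M)%N -> (d.+1%:R ^+ d.+1)^-1 * (q M - q N0) <=
    total (fun n => C ^+ 2 * u n ^+ 2).
  move=> N0M; apply: le_trans (le_sum_total (face_points_uniq N0 M) _ _).
  - rewrite big_allpairs_dep -(telescope_sumr q N0M) mulr_sumr.
    apply: ler_sum_nat => N /andP[NN _].
    apply: (@le_trans _ _ (\sum_(v : {ffun 'I_d -> 'I_N})
        radial (d.+1%:R / 2) s (face_point v) ^+ 2)).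
      apply: face_sum_ge => [|k ks|k ks|k ks]; first exact: leq_ltn_trans NN.
      + by apply: hX (leqW ks); exact: large.
      + by apply: hX (leqW ks); exact: largeD.
      + by apply: hX (leqW ks); apply: largeD; exact: leqW.
    apply: ler_sum => v _; rewrite -exprMn lerXn2r ?nnegrE ?expR_ge0//.
    by apply: le_trans (wu _); exact: expR_ge0.
  - by move=> n; rewrite -exprMn sqr_ge0.
  - exact: abs_summableZ.
set t := total _ in key.
have [Y hY] := iter_log_large s.+1 (q N0 + (t + 1) * d.+1%:R ^+ d.+1).
have [M YM] := bnd Y.
have := key (N0 + M)%N (leq_addr _ _).
rewrite leNgt => /negP; apply; rewrite mulrC ltr_pdivlMr ?exprn_gt0//.
have /hY : Y <= d.+1%:R * (N0 + M)%:R.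
  apply: le_trans YM _; rewrite -natrM ler_nat.
  by rewrite (leq_trans (leq_addl N0 M))// leq_pmull.
rewrite -/(q _) => h; rewrite ltrBrDl; apply: lt_le_trans h.
by rewrite ltrD2l ltr_pM2r ?exprn_gt0// ltrDl.
Qed.

End Divergence.

Theorem theorem1 (R : realType) (d : nat) (hd : (0 < d)%N)
    (V : 'rV[int]_d -> R)
    (hV : exists s : nat, exists r : R, forall n : 'rV[int]_d, r <= znorm R n ->
       V n <= d%:R * (4 - d%:R) / (4 * znorm R n ^+ 2)
            + 1 / znorm R n ^+ 2 *
              \sum_(1 <= j < s.+1) \prod_(1 <= k < j.+1)
                 (1 / iter_log k (znorm R n))) :
  ~ point_spectrum (schrodinger_dom V) (schrodinger V) 0 \/
  0%E <> inf_spectrum (schrodinger_dom V) (schrodinger V).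
Proof.
apply/not_andP => -[zero_mode inf0].
(* Writing the dimension as a successor singles out the coordinate that is constant on the faces. *)
case: d hd V hV zero_mode inf0 => // d _ V [s [r hV]] zero_mode inf0.
have [u [u2 u0 hu]] := positive_zero_mode (esym inf0) zero_mode.
have [X1 sub] := @subsolution R d.+1 s.
have [X2 super] := @supersolution R d.+1 s.
have [X3 ratio] := @radial_ratio R d.+1 s.+1.
have [X4 logs] := iter_logs_large s.+1 (1 : R).
have [] := @comparison R d.+1 V (@critical R d.+1 s.+1) u (radial (d.+1%:R / 2) s.+1)
  (radial (d.+1%:R / 2 - 1) 0)
  (Num.max (Num.max r X1) (Num.max X2 X4)) u0 hu (@radial_gt0 R d.+1 _ _).
- move=> n; rewrite !ge_max => /andP[/andP[nr n1] /andP[n2 n4]].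
  split; [|exact: sub|exact: super].
  have L1 := logs _ n4; have n0 : 0 < znorm R n by apply: lt_le_trans ltr01 (L1 0%N _).
  (* The potential bound with one more logarithm is larger by one log product, nonnegative far
     out. *)
  apply: le_trans (hV n nr) _; rewrite -/(critical R s n) !criticalE ?gt_eqF//.
  rewrite ler_pM2r ?invr_gt0 ?exprn_gt0// lerD2l [leRHS]big_nat_recr//= lerDl.
  exact: logprod_ge0 L1 (leqnn _).
- by move=> e e0; exists (Num.max X3 e^-1); exact: ratio.
by move=> C _; exact: radial_not_dominated.
Qed.
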